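(* Let $n\ge 1$ and let $T\subset\mathbb{R}^n$ be a countable set satisfying the angular equidistribution condition and the radial growth condition (both defined in the context). For $0\le\lambda\le 2$ let $$\Psi(\lambda)=\{(\mathbf a,\mathbf b)\in\mathbb{R}^n\times\mathbb{R}^n : |\mathbf a|\le 1,\ |\mathbf b|\le 1,\ |\mathbf a-\mathbf b|\le\lambda\}\subset\mathbb{R}^{2n}.$$ Then for every $\lambda\in[0,2]$, $$\lim_{R\to\infty}\frac{\#\{(\mathbf a,\mathbf b)\in T\times T:\ |\mathbf a|\le R,\ |\mathbf b|\le R,\ |\mathbf a-\mathbf b|\le\lambda R\}}{\#\{(\mathbf a,\mathbf b)\in T\times T:\ |\mathbf a|\le R,\ |\mathbf b|\le R\}}=\frac{m(\Psi(\lambda))}{m(B_n)^2}=F_n(\lambda),$$ where $$F_n(\lambda)=\frac{1}{\mathrm{B}\left(\frac{n+1}{2},\frac12\right)}\left(\lambda^n\,\mathrm{B}_{1-\frac{\lambda^2}{4}}\left(\tfrac{n+1}{2},\tfrac12\right)+2^n\,\mathrm{B}_{\frac{\lambda^2}{4}}\left(\tfrac{n+1}{2},\tfrac{n+1}{2}\right)\right).$$ Moreover, $F_n$ is the cumulative distribution function on $[0,2]$ of a probability distribution with density $$P_n(\lambda)=n\lambda^{n-1}I_{1-\frac{\lambda^2}{4}}\left(\tfrac{n+1}{2},\tfrac12\right).$$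
   Context: Notation: $|\cdot|$ is the Euclidean norm on $\mathbb{R}^n$; $B_n(r)$ is the closed ball of radius $r$ centered at $\mathbf 0$, $B_n=B_n(1)$, $\mathbb S^{n-1}=\partial B_n$; $m$ is (unnormalized) Lebesgue measure on the relevant Euclidean space; $\mu_P$ is the Lebesgue (uniform, rotation-invariant) probability measure on $\mathbb S^{n-1}$; $\hat{\mathbf x}=\mathbf x/|\mathbf x|$ for $\mathbf x\neq\mathbf 0$. Conditions on $T$: every ball contains finitely many points of $T$, and $N(r)$ denotes the number of $\mathbf x\in T$ with $|\mathbf x|<r$ (with $N(r)>0$ for all large $r$). Angular condition: for every continuous $f:\mathbb S^{n-1}\to\mathbb{R}$, extended to $\mathbb{R}^n\setminus\{\mathbf 0\}$ by $f(\mathbf x)=f(\hat{\mathbf x})$ (with an arbitrary value at $\mathbf 0$), $$\lim_{r\to\infty}\frac{1}{|T\cap B_n(r)|}\sum_{\mathbf x\in T\cap B_n(r)}f(\mathbf x)=\int_{\mathbb S^{n-1}}f\,d\mu_P.$$ Radial (growth) condition: for every fixed $\lambda>0$, $\lim_{r\to\infty}N(r\lambda)/N(r)=\lambda^n$. Special functions: for $a,b>0$ and $0\le x\le1$, $\mathrm{B}_x(a,b)=\int_0^x t^{a-1}(1-t)^{b-1}\,dt$, $\mathrm{B}(a,b)=\mathrm{B}_1(a,b)$, and $I_x(a,b)=\mathrm{B}_x(a,b)/\mathrm{B}(a,b)$. *)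

(* Defs.v *)
From HB Require Import structures.
From mathcomp Require Import all_boot all_order all_algebra.
From mathcomp Require Import finmap.
From mathcomp Require Import all_classical all_reals all_analysis.
From mathcomp Require Import measurable_realfun.
Import Order.TTheory GRing.Theory Num.Theory.
Import numFieldNormedType.Exports.

Set Implicit Arguments.
Unset Strict Implicit.
Unset Printing Implicit Defensive.

Local Open Scope classical_set_scope.
Local Open Scope ring_scope.

(* Equals 0 on infinite sets; it is only used on sets that local finiteness
   makes finite. *)
Definition ncard (T : choiceType) (A : set T) : nat := #|` fset_set A|.

(** The norm [`|x|] that the library puts on ['rV[R]_n] is the sup norm, hence
    [norm2]; the two induce the same topology. *)
Section euclidean.
Context {R : realType} {n : nat}.
Implicit Types (x c : 'rV[R]_n) (r : R).

Definition norm2 x : R := Num.sqrt (\sum_(i < n) x 0 i ^+ 2).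

Definition cball c r : set 'rV[R]_n := [set x | norm2 (x - c) <= r].

Definition unit_sphere : set 'rV[R]_n := [set x | norm2 x = 1].

(* maps 0 to 0 *)
Definition direction x : 'rV[R]_n := (norm2 x)^-1 *: x.

End euclidean.

(** The product sigma-algebra on row vectors, generated by the coordinate maps;
    on ['rV[R]_n] this is the Borel sigma-algebra. *)
Definition rV_display : measure_display -> measure_display.
Proof. exact. Qed.

Section measurable_rV.
Context {d} {T : measurableType d} (n : nat).

Definition rV_coord (i : 'I_n) (x : 'rV[T]_n) : T := x ord0 i.

Let rV_set0 : g_sigma_preimage rV_coord set0.
Proof. exact: sigma_algebra0. Qed.

Let rV_setC A : g_sigma_preimage rV_coord A -> g_sigma_preimage rV_coord (~` A).
Proof. exact: sigma_algebraC. Qed.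

Let rV_bigcup (F : (set 'rV[T]_n)^nat) :
  (forall i, g_sigma_preimage rV_coord (F i)) ->
  g_sigma_preimage rV_coord (\bigcup_i (F i)).
Proof. exact: sigma_algebra_bigcup. Qed.

HB.instance Definition _ := @isMeasurable.Build (rV_display d)
  'rV[T]_n (g_sigma_preimage rV_coord) rV_set0 rV_setC rV_bigcup.

End measurable_rV.


Lemma measurable_rV_coord d (T : measurableType d) n (i : 'I_n) :
  measurable_fun setT (rV_coord i : 'rV[T]_n -> T).
Proof.
move=> _ Y mY; rewrite setTI; apply: sub_sigma_algebra => /=.
rewrite -bigcup_seq/=; exists i => /=; first by rewrite mem_index_enum.
by exists Y => //; rewrite setTI.
Qed.

Lemma measurable_fun_rV d1 d2 (T1 : measurableType d1) (T2 : measurableType d2)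
    n (f : T1 -> 'rV[T2]_n) :
  (forall i, measurable_fun setT (rV_coord i \o f)) -> measurable_fun setT f.
Proof.
move=> mf.
suff : g_sigma_preimage (fun i => rV_coord i \o f) `<=` measurable.
  rewrite g_sigma_preimage_comp => prefS _ A mA.
  by apply: prefS; exists A.
apply: smallest_sub; first exact: sigma_algebra_measurable.
case: n => [|n] in f mf *; first by rewrite big_ord0.
rewrite -bigcup_mkord_ord; apply: bigcup_sub => i Ii.
by move=> A [B mB <-]; exact: mf.
Qed.

(** Lebesgue measure on R^n: the n-fold product of Lebesgue measure on R,
    transported along R * R^n = R^(1 + n). *)
Section lebesgue_rV.
Context {R : realType}.
Local Open Scope ereal_scope.

Definition cons_rV n (p : measurableTypeR R * 'rV[R]_n) : 'rV[R]_(1 + n) :=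
  row_mx (const_mx (p.1 : R)) p.2.

Lemma measurable_cons_rV n : measurable_fun setT (@cons_rV n).
Proof.
apply: measurable_fun_rV => i; case: (splitP i) => j ij.
  rewrite (_ : _ \o _ = fst); first exact: measurable_fst.
  apply/funext => p /=.
  by rewrite /rV_coord (_ : i = lshift n j) ?row_mxEl ?mxE//; exact: val_inj.
rewrite (_ : _ \o _ = rV_coord j \o snd); last first.
  apply/funext => p /=; rewrite /rV_coord (_ : i = rshift 1 j) ?row_mxEr//.
  exact: val_inj.
exact: measurableT_comp (measurable_rV_coord j) measurable_snd.
Qed.

Section lebesgue_cons.
Variables (n : nat) (m : {sigma_finite_measure set 'rV[R]_n -> \bar R}).

Let mc := @measurable_cons_rV n.

Definition lebesgue_cons : set 'rV[R]_(1 + n) -> \bar R :=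
  pushforward (lebesgue_measure \x m) (@cons_rV n).

Let lebesgue_cons0 : lebesgue_cons set0 = 0.
Proof. by rewrite /lebesgue_cons /pushforward preimage_set0 measure0. Qed.

Let lebesgue_cons_ge0 A : 0 <= lebesgue_cons A.
Proof. by rewrite /lebesgue_cons /pushforward. Qed.

Let lebesgue_cons_sigma_additive : semi_sigma_additive lebesgue_cons.
Proof.
exact: (@measure_semi_sigma_additive _ _ _
  (@pushforward _ _ _ _ R (lebesgue_measure \x m)%E (@cons_rV n)
    : {measure set _ -> \bar R})).
Qed.

HB.instance Definition _ := isMeasure.Build _ _ _ lebesgue_cons
  lebesgue_cons0 lebesgue_cons_ge0 lebesgue_cons_sigma_additive.

Let lebesgue_cons_sigma_finite : sigma_finite setT lebesgue_cons.
Proof.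
have /sigma_finiteP[F [TF ndF Ffin]] := sigma_finiteT (@lebesgue_measure R).
have /sigma_finiteP[G [TG ndG Gfin]] := sigma_finiteT m.
pose H k := [set x : 'rV[R]_(1 + n) |
  F k (rV_coord ord0 x) /\ G k (rsubmx x)].
have pre k : @cons_rV n @^-1` H k = F k `*` G k.
  have c0 x v : rV_coord ord0 (@cons_rV n (x, v)) = x.
    have -> : (ord0 : 'I_(1 + n)) = lshift n ord0 by exact: val_inj.
    by apply: (etrans (row_mxEl _ _ _ _)); rewrite mxE.
  by apply/seteqP; split => -[x v]; rewrite /H /= c0 /cons_rV row_mxKr.
exists H.
  apply/esym; rewrite -subTset => x _.
  have [i _ Fi] : (\bigcup_i F i) (rV_coord ord0 x) by rewrite -TF.
  have [j _ Gj] : (\bigcup_i G i) (rsubmx x) by rewrite -TG.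
  exists (maxn i j) => //; split.
  - by move/subsetPset : (ndF _ _ (leq_maxl i j)); apply.
  - by move/subsetPset : (ndG _ _ (leq_maxr i j)); apply.
move=> k; split; last first.
  have [mF Foo] := Ffin k; have [mG Goo] := Gfin k.
  rewrite /lebesgue_cons /pushforward pre product_measure1E//.
  by rewrite lte_mul_pinfty// ge0_fin_numE.
have mr : measurable_fun setT (rsubmx : 'rV[R]_(1 + n) -> 'rV[R]_n).
  apply: measurable_fun_rV => i.
  rewrite (_ : _ \o _ = rV_coord (rshift 1 i)); first exact: measurable_rV_coord.
  by apply/funext => x; rewrite /rV_coord /= mxE.
apply: measurableI.
  rewrite -[X in measurable X]setTI.
  by apply: (@measurable_rV_coord _ R (1 + n) ord0) => //; exact: (Ffin k).1.
by rewrite -[X in measurable X]setTI; apply: mr => //; exact: (Gfin k).1.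
Qed.

HB.instance Definition _ :=
  Measure_isSigmaFinite.Build _ _ _ lebesgue_cons lebesgue_cons_sigma_finite.

End lebesgue_cons.

Fixpoint lebesgue_rV n : {sigma_finite_measure set 'rV[R]_n -> \bar R} :=
  match n return {sigma_finite_measure set 'rV[R]_n -> \bar R} with
  | 0 => \d_(0%R : 'rV[R]_0)
  | n'.+1 => (lebesgue_cons (lebesgue_rV n')
              : {sigma_finite_measure set 'rV[R]_(1 + n') -> \bar R})
  end.

End lebesgue_rV.

(** The uniform probability measure on the unit sphere, in its cone form: the
    measure of [A] is the proportion of the unit ball filled by the points whose
    direction lies in [A]. *)
Section sphere_measure.
Context {R : realType} (n : nat).

Lemma measurable_norm2 : measurable_fun setT (@norm2 R n).
Proof.
apply: measurableT_comp.
  exact: continuous_measurable_fun (@sqrt_continuous R).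
apply: measurable_sum => i; apply: measurable_funX.
exact: measurable_rV_coord.
Qed.

Lemma measurable_direction : measurable_fun setT (@direction R n).
Proof.
apply: measurable_fun_rV => i.
rewrite (_ : _ \o _ = fun x => norm2 x `^ (-1) * rV_coord i x).
  apply: measurable_funM; last exact: measurable_rV_coord.
  exact: measurableT_comp (measurable_powR _) measurable_norm2.
by apply/funext => x; rewrite powR_inv1 ?sqrtr_ge0// /rV_coord /= mxE.
Qed.

Lemma measurable_unit_ball : measurable (cball 0 1 : set 'rV[R]_n).
Proof.
rewrite (_ : cball 0 1 = @norm2 R n @^-1` `]-oo, 1]); last first.
  by apply/seteqP; split => x; rewrite /cball /= subr0 in_itv.
by rewrite -[X in measurable X]setTI; exact: measurable_norm2.
Qed.

Lemma inv_vol_ge0 : 0 <= (fine (lebesgue_rV n (@cball R n 0 1)))^-1.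
Proof. by rewrite invr_ge0 fine_ge0. Qed.

Definition unif_ball : {measure set 'rV[R]_n -> \bar R} :=
  mscale (NngNum inv_vol_ge0) (mrestr (lebesgue_rV n) measurable_unit_ball).

Definition sphere_measure : set 'rV[R]_n -> \bar R :=
  pushforward unif_ball (@direction R n).

Let mdir := measurable_direction.

Let sphere_measure0 : sphere_measure set0 = 0%E.
Proof. by rewrite /sphere_measure /pushforward preimage_set0 measure0. Qed.

Let sphere_measure_ge0 A : (0 <= sphere_measure A)%E.
Proof. by rewrite /sphere_measure /pushforward. Qed.

Let sphere_measure_sigma_additive : semi_sigma_additive sphere_measure.
Proof.
exact: (@measure_semi_sigma_additive _ _ _
  (@pushforward _ _ _ _ R unif_ball (@direction R n)
    : {measure set _ -> \bar R})).
Qed.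

HB.instance Definition _ := isMeasure.Build _ _ _ sphere_measure
  sphere_measure0 sphere_measure_ge0 sphere_measure_sigma_additive.

End sphere_measure.
Arguments unif_ball {R} n.
Arguments sphere_measure {R} n.

Section point_sets.
Context {R : realType} {n : nat}.
Variable T : set 'rV[R]_n.

Definition locally_finite : Prop :=
  forall (c : 'rV[R]_n) (r : R), finite_set (T `&` cball c r).

Definition npoints (r : R) : nat := ncard [set x | T x /\ norm2 x < r].

Definition eventually_nonempty : Prop := \forall r \near +oo, (0 < npoints r)%N.

(* [f] stands for the extension to R^n of a continuous function on the sphere;
   its value at 0 is unconstrained. *)
Definition angular_condition : Prop :=
  forall f : 'rV[R]_n -> R,
    {within unit_sphere, continuous f} ->
    (forall x, x != 0 -> f x = f (direction x)) ->
    (\sum_(x \in T `&` cball 0 r) f x) / (ncard (T `&` cball 0 r))%:R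
      @[r --> +oo] --> \int[sphere_measure n]_(x in unit_sphere) f x.

Definition radial_condition : Prop :=
  forall lambda : R, 0 < lambda ->
    (npoints (r * lambda))%:R / (npoints r)%:R @[r --> +oo] --> lambda ^+ n.

Definition pairs (r : R) : set ('rV[R]_n * 'rV[R]_n) :=
  [set p | [/\ T p.1, T p.2, norm2 p.1 <= r & norm2 p.2 <= r]].

Definition close_pairs (lambda r : R) : set ('rV[R]_n * 'rV[R]_n) :=
  [set p | [/\ T p.1, T p.2, norm2 p.1 <= r, norm2 p.2 <= r &
               norm2 (p.1 - p.2) <= lambda * r]].

End point_sets.

(* Psi(lambda), with (a, b) encoded as the concatenated vector of R^(n + n) *)
Definition Psi {R : realType} (n : nat) (lambda : R) : set 'rV[R]_(n + n) :=
  [set v | [/\ norm2 (lsubmx v) <= 1, norm2 (rsubmx v) <= 1 &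
               norm2 (lsubmx v - rsubmx v) <= lambda]].
Arguments Psi {R} n lambda.

Section special_functions.
Context {R : realType}.
Implicit Types (x a b lambda : R) (n : nat).

Definition inc_beta x a b : R :=
  \int[lebesgue_measure]_(t in `[0, x]) (t `^ (a - 1) * (1 - t) `^ (b - 1)).

Definition beta a b : R := inc_beta 1 a b.

Definition reg_beta x a b : R := inc_beta x a b / beta a b.

Definition F_ n lambda : R :=
  (beta (n.+1%:R / 2) (1 / 2))^-1 *
  (lambda ^+ n * inc_beta (1 - lambda ^+ 2 / 4) (n.+1%:R / 2) (1 / 2) +
   2 ^+ n * inc_beta (lambda ^+ 2 / 4) (n.+1%:R / 2) (n.+1%:R / 2)).

Definition P_ n lambda : R :=
  n%:R * lambda ^+ n.-1 *
  reg_beta (1 - lambda ^+ 2 / 4) (n.+1%:R / 2) (1 / 2).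

End special_functions.

(* [F] is, on [0, 2], the cumulative distribution function of a probability
   distribution on R that has density [p] on [0, 2] and 0 elsewhere. *)
Definition cdf_with_density {R : realType} (F p : R -> R) : Prop :=
  [/\ measurable_fun (`[0, 2] : set R) p,
      (forall x : R, 0 <= x <= 2 -> 0 <= p x) &
      exists Q : probability (measurableTypeR R) R,
        (forall A : set (measurableTypeR R), measurable A ->
           Q A = (\int[lebesgue_measure]_(x in A `&` `[0%R, 2%R]) (p x)%:E)%E) /\
        (forall x : R, 0 <= x <= 2 -> Q `]-oo, x]%classic = (F x)%:E)].

(* Main.v *)
Require Import Defs.
From HB Require Import structures.
From mathcomp Require Import all_boot all_order all_algebra.
From mathcomp Require Import finmap.
From mathcomp Require Import all_classical all_reals all_analysis.
From mathcomp Require Import measurable_realfun ring lra.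
Import Order.TTheory GRing.Theory Num.Theory.
Import numFieldNormedType.Exports.

(** Rescaled by 1 / r, the points of T in the ball of radius r become equidistributed
    in the unit ball, hence pairs of them become equidistributed in the product of two
    unit balls, and the proportion of pairs at distance at most lambda tends to the
    proportion psi_ratio of that product filled by Psi lambda. It remains to compute
    psi_ratio.

    Volume. With b = a + c, the volume of Psi lambda is the integral over
    |c| <= lambda of the volume of the lens in which the unit ball meets its translate
    by - c (lebesgue_Psi). Lebesgue measure is invariant under isometries, because a
    translation invariant measure is determined up to a factor (linear_change); so the
    lens depends on |c| only. It consists of two caps, and integrating the slices of
    a cap and substituting u = 1 - x ^ 2 shows that it fills the proportion
    overlap |c| = I_(1 - |c| ^ 2 / 4)((n + 1) / 2, 1 / 2) of the ball
    (lebesgue_lensE, reg_beta_overlap). Polar coordinates are avoided as follows. The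
    overlap is nonincreasing, and for s <= t the increments from s to t of three
    functions of lambda, namely psi_ratio, F_n and the integral of P_n over
    [0, lambda], all lie between overlap t (t ^ n - s ^ n) and
    overlap s (t ^ n - s ^ n). These bounds determine a function up to its value
    at 0 (sandwiched_unique), so the three functions coincide; since psi_ratio 2 = 1,
    F_n is a distribution function with density P_n.

    Limit. The angular and radial conditions give the limit of the means over T of a
    function of the direction restricted to a ball (equidistributed_cone). Cutting the
    unit ball into thin shells extends this to Lipschitz functions
    (admissible_lipschitz). For a Lipschitz function of two points, the convergence of
    the mean over the second point is uniform in the first by compactness, so the mean
    over pairs converges too (ramp_pair_mean). The indicator of distance at most lambda
    is squeezed between Lipschitz functions of the distance, whose limits are close
    because psi_ratio is Lipschitz on [0, 2] (close_pair_mean_cvg). *)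

Set Implicit Arguments.
Unset Strict Implicit.
Unset Printing Implicit Defensive.

Local Open Scope classical_set_scope.
Local Open Scope ring_scope.

(** * The Euclidean norm *)

Section norm2_theory.
Context {R : realType} {n : nat}.
Implicit Types (x y : 'rV[R]_n) (r : R).

Definition dot x y : R := \sum_(i < n) x 0 i * y 0 i.

Lemma dotC x y : dot x y = dot y x.
Proof. by apply: eq_bigr => i _; rewrite mulrC. Qed.

Lemma dotDl x y z : dot (x + y) z = dot x z + dot y z.
Proof. by rewrite -big_split; apply: eq_bigr => i _; rewrite mxE mulrDl. Qed.

Lemma dotZl r x y : dot (r *: x) y = r * dot x y.
Proof. by rewrite mulr_sumr; apply: eq_bigr => i _; rewrite mxE mulrA. Qed.

Lemma dotDr x y z : dot z (x + y) = dot z x + dot z y.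
Proof. by rewrite dotC dotDl !(dotC z). Qed.

Lemma dotZr r x y : dot x (r *: y) = r * dot x y.
Proof. by rewrite dotC dotZl dotC. Qed.

Lemma dot_ge0 x : 0 <= dot x x.
Proof. by apply: sumr_ge0 => i _; rewrite -expr2 sqr_ge0. Qed.

Lemma dot_eq0 x : dot x x = 0 -> x = 0.
Proof.
move=> /psumr_eq0P x0; apply/rowP => i; rewrite mxE; apply/eqP.
by rewrite -[_ == _]orbb -mulf_eq0; apply/eqP/x0 => // j _; rewrite -expr2 sqr_ge0.
Qed.

Lemma norm2E x : norm2 x = Num.sqrt (dot x x).
Proof. by congr Num.sqrt; apply: eq_bigr => i _; rewrite expr2. Qed.

Lemma norm2_ge0 x : 0 <= norm2 x. Proof. exact: sqrtr_ge0. Qed.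

Lemma sqr_norm2 x : norm2 x ^+ 2 = dot x x.
Proof. by rewrite norm2E sqr_sqrtr// dot_ge0. Qed.

Lemma norm2_eq0 x : norm2 x = 0 -> x = 0.
Proof. by move=> x0; apply: dot_eq0; rewrite -sqr_norm2 x0 expr0n. Qed.

Lemma norm20 : norm2 (0 : 'rV[R]_n) = 0.
Proof.
by rewrite /norm2 big1 ?sqrtr0// => i _; rewrite mxE expr0n.
Qed.

Lemma norm2Z r x : norm2 (r *: x) = `|r| * norm2 x.
Proof.
by rewrite !norm2E dotZl dotZr mulrA -expr2 sqrtrM ?sqr_ge0// sqrtr_sqr.
Qed.

Lemma norm2N x : norm2 (- x) = norm2 x.
Proof. by rewrite -scaleN1r norm2Z normrN1 mul1r. Qed.

Lemma norm2_distC x y : norm2 (x - y) = norm2 (y - x).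
Proof. by rewrite -norm2N opprB. Qed.

(** Cauchy-Schwarz: the vector |y| x - |x| y has a nonnegative square. *)
Lemma dot_le_norm2 x y : dot x y <= norm2 x * norm2 y.
Proof.
have [/norm2_eq0 ->|x0] := eqVneq (norm2 x) 0.
  by rewrite norm20 mul0r -(scale0r 0) dotZl mul0r.
have [/norm2_eq0 ->|y0] := eqVneq (norm2 y) 0.
  by rewrite norm20 mulr0 -(scale0r 0) dotZr mul0r.
have {}x0 : 0 < norm2 x by rewrite lt_neqAle eq_sym x0 norm2_ge0.
have {}y0 : 0 < norm2 y by rewrite lt_neqAle eq_sym y0 norm2_ge0.
have := dot_ge0 (norm2 y *: x + (- norm2 x) *: y).
rewrite !(dotDl, dotDr, dotZl, dotZr) (dotC y x) -!sqr_norm2 => h.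
rewrite -subr_ge0 -(pmulr_rge0 _ (mulr_gt0 x0 y0)); nra.
Qed.

Lemma ler_norm2D x y : norm2 (x + y) <= norm2 x + norm2 y.
Proof.
rewrite -(ler_pXn2r (n := 2)) ?nnegrE ?addr_ge0 ?norm2_ge0//.
rewrite sqrrD !sqr_norm2 !(dotDl, dotDr) (dotC y x).
have := dot_le_norm2 x y; lra.
Qed.

Lemma ler_norm2B x y : norm2 (x - y) <= norm2 x + norm2 y.
Proof. by rewrite -(norm2N y); exact: ler_norm2D. Qed.

Lemma ler_dist_norm2 x y : `|norm2 x - norm2 y| <= norm2 (x - y).
Proof.
have h1 := ler_norm2D (x - y) y; have h2 := ler_norm2D (y - x) x.
rewrite !subrK in h1 h2; rewrite (norm2_distC y x) in h2.
by rewrite ler_norml; apply/andP; split; lra.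
Qed.

Lemma coord_le_norm2 x i : `|x 0 i| <= norm2 x.
Proof.
rewrite -sqrtr_sqr; apply: ler_wsqrtr; rewrite (bigD1 i)//= lerDl.
by apply: sumr_ge0 => j _; exact: sqr_ge0.
Qed.

End norm2_theory.

Lemma norm2_row_mx (R : realType) n p (x : 'rV[R]_n) (y : 'rV[R]_p) :
  norm2 (row_mx x y) ^+ 2 = norm2 x ^+ 2 + norm2 y ^+ 2.
Proof.
rewrite !sqr_norm2 /dot big_split_ord.
by congr +%R; apply: eq_bigr => i _; rewrite ?row_mxEl ?row_mxEr.
Qed.

(** * Measurability of maps into row vectors *)

Section measurable_row.
Context {R : realType} {n : nat} d (T : measurableType d).
Implicit Types (f g : T -> 'rV[R]_n).

Lemma measurable_rV_coord_comp f (i : 'I_n) :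
  measurable_fun setT f -> measurable_fun setT (fun x => f x 0 i).
Proof. by move=> mf; exact: measurableT_comp (measurable_rV_coord i) mf. Qed.

Lemma measurable_rVD f g : measurable_fun setT f -> measurable_fun setT g ->
  measurable_fun setT (fun x => f x + g x).
Proof.
move=> mf mg; apply: measurable_fun_rV => i.
rewrite (_ : _ \o _ = fun x => f x 0 i + g x 0 i); last first.
  by apply/funext => x /=; rewrite /rV_coord mxE.
by apply: measurable_funD; exact: measurable_rV_coord_comp.
Qed.

Lemma measurable_rVZ (k : T -> R) f :
  measurable_fun setT k -> measurable_fun setT f ->
  measurable_fun setT (fun x => k x *: f x).
Proof.
move=> mk mf; apply: measurable_fun_rV => i.
rewrite (_ : _ \o _ = fun x => k x * f x 0 i); last first.
  by apply/funext => x /=; rewrite /rV_coord mxE.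
by apply: measurable_funM => //; exact: measurable_rV_coord_comp.
Qed.

Lemma measurable_rVN f : measurable_fun setT f ->
  measurable_fun setT (fun x => - f x).
Proof.
move=> mf; under eq_fun do rewrite -scaleN1r.
exact: measurable_rVZ.
Qed.

Lemma measurable_rVB f g : measurable_fun setT f -> measurable_fun setT g ->
  measurable_fun setT (fun x => f x - g x).
Proof. by move=> mf mg; apply: measurable_rVD => //; exact: measurable_rVN. Qed.

Lemma measurable_norm2_comp f : measurable_fun setT f ->
  measurable_fun setT (fun x => norm2 (f x)).
Proof. by move=> mf; exact: measurableT_comp (@measurable_norm2 R n) mf. Qed.

Lemma measurable_le_set (f g : T -> R) :
  measurable_fun setT f -> measurable_fun setT g ->
  measurable [set x | f x <= g x].
Proof.
move=> mf mg; have := measurable_fun_ler mf mg.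
move=> /(_ measurableT [set true] I); rewrite setTI.
by congr measurable; apply/seteqP; split => x /=.
Qed.

Lemma measurable_lt_set (f g : T -> R) :
  measurable_fun setT f -> measurable_fun setT g ->
  measurable [set x | f x < g x].
Proof.
move=> mf mg; have := measurable_fun_ltr mf mg.
move=> /(_ measurableT [set true] I); rewrite setTI.
by congr measurable; apply/seteqP; split => x /=.
Qed.

End measurable_row.

Lemma measurable_preimage d d' (T : measurableType d) (T' : measurableType d')
    (f : T -> T') (A : set T') :
  measurable_fun setT f -> measurable A -> measurable (f @^-1` A).
Proof. by move=> mf mA; rewrite -[X in measurable X]setTI; exact: mf. Qed.

(** The eta-expanded form that a goal presents when the identity is one argument
    of a pointwise operation. *)
Lemma measurable_id_eta d (T : measurableType d) (D : set T) :
  measurable_fun D (fun x : T => x).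
Proof. exact: measurable_id. Qed.

#[local] Hint Resolve measurable_id_eta measurable_fst measurable_snd : core.

(** * Lebesgue measure on R^n: Tonelli, translations, linear maps *)

Section integral_rV.
Context {R : realType}.
Local Open Scope ereal_scope.
Local Notation mu := (@lebesgue_measure R).
Local Notation m n := (@lebesgue_rV R n).

Lemma integral_shift_lebesgue (f : measurableTypeR R -> \bar R) (c : R) :
  measurable_fun setT f -> (forall t, 0 <= f t) ->
  \int[mu]_t f (t + c)%R = \int[mu]_t f t.
Proof.
move=> mf f0.
have mc : measurable_fun [set: measurableTypeR R]
    ((fun t => t + c)%R : _ -> measurableTypeR R).
  exact: measurable_funD.
pose nu := pushforward mu ((fun t => t + c)%R : _ -> measurableTypeR R).
transitivity (\int[nu]_t f t); first by rewrite ge0_integral_pushforward.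
apply: eq_measure_integral => //= A mA _; apply/esym.
apply: lebesgue_measure_unique => // _ [[a b]] _ <-.
rewrite /= /pushforward.
rewrite (_ : _ @^-1` _ = `](a - c)%R, (b - c)%R]%classic); last first.
  by apply/seteqP; split => x /=; rewrite !in_itv/= ltrBlDr lerBrDr.
rewrite !lebesgue_measure_itv/= !lte_fin ltrD2r; case: ifPn => // _.
by rewrite -!EFinB; congr EFin; lra.
Qed.

Lemma measurable_cons_rV_comp n d (T : measurableType d) (f : T -> R)
    (g : T -> 'rV[R]_n) : measurable_fun setT f -> measurable_fun setT g ->
  measurable_fun setT (fun x => cons_rV (f x, g x)).
Proof.
move=> mf mg; apply: measurableT_comp (@measurable_cons_rV R n) _.
exact: measurable_fun_pair.
Qed.

(** Tonelli for the splitting of the first coordinate by which the measure is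
    defined; every volume below is computed through it. *)
Lemma integral_cons n (h : 'rV[R]_n.+1 -> \bar R) :
  measurable_fun setT h -> (forall x, 0 <= h x) ->
  \int[m n.+1]_x h x = \int[mu]_t \int[m n]_y h (cons_rV (t, y)).
Proof.
move=> mh h0.
transitivity (\int[mu \x m n]_p h (cons_rV p)).
  rewrite [LHS](_ : _ = \int[pushforward (mu \x m n)%E (@cons_rV R n)]_x h x)//.
  rewrite ge0_integral_pushforward//.
  exact: measurable_cons_rV.
rewrite fubini_tonelli1//.
by apply: measurableT_comp mh _; exact: measurable_cons_rV.
Qed.

Lemma cons_rVD n (a b : R) (x y : 'rV[R]_n) :
  (cons_rV (a, x) + cons_rV (b, y))%R = cons_rV ((a + b)%R, (x + y)%R).
Proof.
rewrite /cons_rV add_row_mx/=; congr (row_mx _ _).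
by apply/rowP => i; rewrite !mxE.
Qed.

Lemma cons_rVK n (x : 'rV[R]_n.+1) :
  x = cons_rV (x 0%R 0%R, (rsubmx (x : 'rV[R]_(1 + n)) : 'rV[R]_n)).
Proof.
rewrite /cons_rV/=; apply: etrans (esym (hsubmxK (x : 'rV[R]_(1 + n)))) _.
congr (row_mx _ _).
apply/rowP => i; rewrite !mxE; congr (x _ _); apply: val_inj => /=.
by rewrite (ord1 i).
Qed.

Lemma cons_rV0 n (a : R) (x : 'rV[R]_n) : cons_rV (a, x) 0%R 0%R = a.
Proof.
rewrite /cons_rV/= (_ : 0%R = lshift n (0%R : 'I_1)); last exact: val_inj.
by rewrite row_mxEl mxE.
Qed.

(** Each coordinate is moved separately, so the invariance of Lebesgue measure on
    the line carries over. *)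
Lemma integral_shift n (c : 'rV[R]_n) (h : 'rV[R]_n -> \bar R) :
  measurable_fun setT h -> (forall x, 0 <= h x) ->
  \int[m n]_x h (x + c)%R = \int[m n]_x h x.
Proof.
elim: n c h => [|n IH] c h mh h0.
  by apply: eq_integral => x _; congr h; apply/rowP => -[].
rewrite integral_cons//; last by apply: measurableT_comp mh _; exact: measurable_rVD.
rewrite [RHS]integral_cons//.
pose F t := \int[m n]_y h (cons_rV (t, y)).
have mF : measurable_fun setT F.
  apply: (measurable_fun_fubini_tonelli_F (fun p => h (cons_rV p))) => //.
  by apply: measurableT_comp mh _; exact: measurable_cons_rV.
rewrite -[RHS](@integral_shift_lebesgue F (c 0 0)%R) => //; last first.
  by move=> t; apply: integral_ge0.
apply: eq_integral => t _.
rewrite -[RHS](IH (rsubmx (c : 'rV[R]_(1 + n)))) => //; last first.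
  by apply: measurableT_comp mh _; exact: measurable_cons_rV_comp.
by apply: eq_integral => y _; rewrite {1}(cons_rVK c) cons_rVD.
Qed.

End integral_rV.

Section linear_change.
Context {R : realType}.
Local Open Scope ereal_scope.
Local Notation m n := (@lebesgue_rV R n).

Lemma measurable_EFin_indic d (T : measurableType d) (A : set T) :
  measurable A -> measurable_fun setT (fun x => (\1_A x : R)%:E).
Proof. by move=> mA; exact/measurable_EFinP. Qed.

Lemma EFin_indic_ge0 (T : Type) (A : set T) x : 0 <= (\1_A x : R)%:E.
Proof. by rewrite lee_fin. Qed.

(** The image of Lebesgue measure under the additive map Q is again invariant under
    translations, hence proportional to it. Concretely, 1_E (Q x) * 1_A (y + Q x)
    is integrated in both orders, and translations of the variables turn each
    iterated integral into a product; the second one involves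
    Q x - E, whose volume is that of E by symmetry. Evaluating at one convenient
    set E then replaces the theory of determinants: a cube serves for dilations,
    the ball for isometries. *)
Lemma linear_change n (Q Q' : 'rV[R]_n -> 'rV[R]_n) (A E : set 'rV[R]_n) :
  measurable_fun setT Q -> (forall x y, Q (x + y) = Q x + Q y)%R ->
  cancel Q' Q -> measurable A -> measurable E -> (forall x, E (- x)%R = E x) ->
  m n (Q @^-1` E) * m n A = m n (Q @^-1` A) * m n E.
Proof.
move=> mQ QD QK mA mE EN.
have mpre B : measurable B -> measurable (Q @^-1` B) by exact: measurable_preimage.
pose h (p : 'rV[R]_n * 'rV[R]_n) : \bar R :=
  (\1_E (Q p.1) : R)%:E * (\1_A (p.2 + Q p.1)%R : R)%:E.
have mQ1 : measurable_fun setT (fun p : 'rV[R]_n * 'rV[R]_n => Q p.1).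
  exact: measurableT_comp.
have mh : measurable_fun setT h.
  apply: emeasurable_funM.
    exact: measurableT_comp (measurable_EFin_indic mE) _.
  by apply: measurableT_comp (measurable_EFin_indic mA) _; exact: measurable_rVD.
have h0 p : 0 <= h p by rewrite mule_ge0 ?EFin_indic_ge0.
have := fubini_tonelli (m1 := m n) (m2 := m n) h mh h0.
have intE B : measurable B -> \int[m n]_x (\1_B x)%:E = m n B.
  by move=> mB; rewrite integral_indic// setIT.
have -> : \int[m n]_x \int[m n]_y h (x, y) = m n (Q @^-1` E) * m n A.
  rewrite /h /=.
  under eq_integral => x _.
    rewrite (@ge0_integralZl _ _ _ (m n) _ measurableT (fun y => (\1_A (y + Q x)%R)%:E))//; last first.
      by apply: measurableT_comp (measurable_EFin_indic mA) _; exact: measurable_rVD.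
    rewrite (@integral_shift _ _ (Q x) (fun y => (\1_A y)%:E))//; last first.
      exact: measurable_EFin_indic.
    rewrite intE//; over.
  rewrite ge0_integralZr//; first by rewrite (intE (Q @^-1` E))//; exact: mpre.
  exact: measurable_EFin_indic (mpre _ mE).
move=> ->; symmetry.
transitivity (\int[m n]_y \int[m n]_x
  ((\1_E (Q x - y)%R : R)%:E * (\1_A (Q x) : R)%:E)); last first.
  apply: eq_integral => y _.
  rewrite -[LHS](integral_shift (Q' y)); last 2 first.
  - apply: emeasurable_funM.
      by apply: measurableT_comp (measurable_EFin_indic mE) _; exact: measurable_rVB.
    exact: measurableT_comp (measurable_EFin_indic mA) _.
  - by move=> x; rewrite mule_ge0 ?EFin_indic_ge0.
  by apply: eq_integral => x _; rewrite /h QD QK addrK (addrC y).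
rewrite -(fubini_tonelli (m1 := m n) (m2 := m n)
  (fun p => (\1_E (Q p.1 - p.2)%R : R)%:E * (\1_A (Q p.1) : R)%:E)); last 2 first.
- apply: emeasurable_funM.
    by apply: measurableT_comp (measurable_EFin_indic mE) _; exact: measurable_rVB.
  exact: measurableT_comp (measurable_EFin_indic mA) _.
- by move=> x; rewrite mule_ge0 ?EFin_indic_ge0.
rewrite /=; under eq_integral => x _.
  rewrite (@ge0_integralZr _ _ _ (m n) _ measurableT (fun y => (\1_E (Q x - y)%R)%:E))//; last first.
    by apply: measurableT_comp (measurable_EFin_indic mE) _; exact: measurable_rVB.
  rewrite (_ : \int[m n]_y _ = m n E); last first.
    rewrite -(intE _ mE).
    rewrite -[RHS](integral_shift (- Q x)%R) //; last exact: measurable_EFin_indic.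
    apply: eq_integral => y _; rewrite !indicE; congr (_%:R%:E).
    congr nat_of_bool; apply/idP/idP => /set_mem; rewrite -EN opprB => Ex.
      exact: mem_set.
    exact: mem_set.
  over.
rewrite ge0_integralZl//; last exact: measurable_EFin_indic (mpre _ mA).
by rewrite muleC (intE (Q @^-1` A))//; exact: mpre.
Qed.

End linear_change.

(** * Volumes of cubes and balls, invariance under isometries *)

Section volumes.
Context {R : realType}.
Local Notation mu := (@lebesgue_measure R).
Local Notation m n := (@lebesgue_rV R n).

Definition cube n (s : R) : set 'rV[R]_n := [set x | forall i, `|x 0 i| <= s].

Lemma lebesgue_rVS n (A : set 'rV[R]_n.+1) :
  m n.+1 A = (mu \x m n)%E (@cons_rV R n @^-1` A).
Proof. by []. Qed.

Lemma cons_rVS n (a : R) (x : 'rV[R]_n) (i : 'I_n) :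
  cons_rV (a, x) 0 (lift 0 i) = x 0 i.
Proof.
rewrite /cons_rV/= (_ : lift 0 i = rshift 1 i); last exact: val_inj.
by rewrite row_mxEr.
Qed.

Lemma cube_cons n s :
  @cons_rV R n @^-1` cube s = `[- s, s]%classic `*` @cube n s.
Proof.
apply/seteqP; split=> -[t y]/=; rewrite in_itv/= -ler_norml.
  move=> h; split; first by have := h 0; rewrite cons_rV0.
  by move=> i; have := h (lift 0 i); rewrite cons_rVS.
move=> [ht hy] i; case: (unliftP 0 i) => [j ->|->]; first by rewrite cons_rVS.
by rewrite cons_rV0.
Qed.

Lemma measurable_cube n s : measurable (@cube n s).
Proof.
rewrite (_ : cube s =
    \bigcap_(i in [set: 'I_n]) [set x : 'rV[R]_n | `|x 0 i| <= s]); last first.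
  by apply/seteqP; split=> [x h i _|x h i]; [exact: h|exact: (h i I)].
apply: fin_bigcap_measurable => // i _.
apply: measurable_le_set => //; apply: measurableT_comp => //.
exact: measurable_rV_coord.
Qed.

Lemma lebesgue_cube n s : 0 <= s -> m n (cube s) = ((2 * s) ^+ n)%:E.
Proof.
move=> s0; elim: n => [|n IH].
  by rewrite /= diracE mem_set// => -[].
rewrite lebesgue_rVS cube_cons product_measure1E//; last exact: measurable_cube.
rewrite [X in (_ * X)%E]IH /= lebesgue_measure_itv/= lte_fin exprS EFinM; congr (_ * _)%E.
case: ifPn => h; first by rewrite -EFinB; congr EFin; lra.
by congr EFin; lra.
Qed.

(** Proportionality is evaluated on a cube, whose volume is known at every scale. *)
Lemma lebesgue_scale n (s : R) (A : set 'rV[R]_n) : 0 < s -> measurable A ->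
  m n ( *:%R s^-1 @^-1` A) = ((s ^+ n)%:E * m n A)%E.
Proof.
move=> s0 mA.
have sN0 : s != 0 by rewrite gt_eqF.
have := @linear_change R n ( *:%R s^-1) ( *:%R s) A (cube 1).
rewrite (_ : _ @^-1` cube 1 = cube s); last first.
  by apply/seteqP; split=> x /= h i; have := h i;
    rewrite mxE normrM ger0_norm ?invr_ge0 ?(ltW s0)// mulrC ler_pdivrMr// mul1r.
rewrite !lebesgue_cube ?(ltW s0)// mulr1 => H.
have {}H : (((2 * s) ^+ n)%:E * m n A = m n ( *:%R s^-1 @^-1` A) * (2 ^+ n)%:E)%E.
  apply: H => //.
  - exact: measurable_rVZ.
  - by move=> x y; rewrite scalerDr.
  - by move=> x; rewrite scalerK.
  - exact: measurable_cube.
  by move=> x; apply/propext; split=> h i; have := h i; rewrite mxE normrN.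
rewrite -[LHS]mule1 -(_ : (2 ^+ n)%:E * ((2 ^+ n)^-1)%:E = 1)%E; last first.
  by rewrite -EFinM divff// expf_neq0.
rewrite muleA -H exprMn EFinM -!muleA muleCA; congr (_ * _)%E.
by rewrite muleCA -EFinM divff ?mule1// expf_neq0.
Qed.

Definition ball_vol n : R := fine (m n (cball 0 1)).

Lemma measurable_cball n (c : 'rV[R]_n) s : measurable (cball c s).
Proof.
by apply: measurable_le_set => //; apply: measurable_norm2_comp; exact: measurable_rVB.
Qed.

Lemma cball_sub_cube n s : @cball R n 0 s `<=` cube s.
Proof.
move=> x; rewrite /cball/= subr0 => xs i; exact: le_trans (coord_le_norm2 x i) xs.
Qed.

Lemma cube_sub_cball n : @cube n n.+1%:R^-1 `<=` cball 0 1.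
Proof.
move=> x h; rewrite /cball/= subr0 norm2E -[leRHS]sqrtr1; apply: ler_wsqrtr.
have -> : 1 = \sum_(i < n.+1) (n.+1%:R^-1 : R).
  by rewrite sumr_const card_ord -[RHS]mulr_natl divff.
rewrite big_ord_recr/= -[leLHS]addr0 lerD ?invr_ge0//.
apply: ler_sum => i _; rewrite (le_trans (ler_norm _))// normrM.
rewrite -[leRHS]mulr1; apply: ler_pM => //.
by rewrite (le_trans (h i))// invf_le1// ler1n.
Qed.

(** The ball lies between two cubes, so its volume is finite and nonzero. *)
Lemma ball_volE n : m n (cball 0 1) = (ball_vol n)%:E.
Proof.
rewrite /ball_vol fineK// ge0_fin_numE//.
have : (m n (cball 0 1) <= m n (cube 1))%E.
  apply: le_measure; [| |exact: cball_sub_cube]; rewrite inE.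
    exact: measurable_cball.
  exact: measurable_cube.
by move=> /le_lt_trans; apply; rewrite lebesgue_cube// ltry.
Qed.

Lemma ball_vol_gt0 n : 0 < ball_vol n.
Proof.
have : (m n (cube n.+1%:R^-1) <= m n (cball 0 1))%E.
  apply: le_measure; [| |exact: cube_sub_cball]; rewrite inE.
    exact: measurable_cube.
  exact: measurable_cball.
rewrite lebesgue_cube// ball_volE lee_fin; apply: lt_le_trans.
by rewrite exprn_gt0// mulr_gt0// invr_gt0.
Qed.

Lemma lebesgue_cball n s : 0 <= s -> m n (cball 0 s) = (s ^+ n * ball_vol n)%:E.
Proof.
rewrite le_eqVlt => /predU1P[<-|s0].
  rewrite (_ : cball 0 0 = cube 0); last first.
    apply/seteqP; split; first exact: cball_sub_cube.
    move=> x h; rewrite /cball/= subr0 (_ : x = 0) ?norm20//.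
    apply/rowP => i; rewrite mxE; apply/eqP; rewrite -normr_le0; exact: h.
  rewrite lebesgue_cube// mulr0; case: n => [|n]; last by rewrite expr0n mul0r.
  rewrite expr0 mul1r -ball_volE /= diracE mem_set//.
  by rewrite /cball/= subr0 norm20.
rewrite EFinM -ball_volE -lebesgue_scale//; last exact: measurable_cball.
congr (m n _); apply/seteqP; split=> x; rewrite /cball/= !subr0 norm2Z;
  by rewrite ger0_norm ?invr_ge0 ?(ltW s0)// mulrC ler_pdivrMr// mul1r.
Qed.

(** Proportionality is evaluated on the unit ball, which Q preserves. *)
Lemma lebesgue_isometry n (Q : 'rV[R]_n -> 'rV[R]_n) (A : set 'rV[R]_n) :
  measurable_fun setT Q -> (forall x y, Q (x + y) = Q x + Q y) ->
  involutive Q -> (forall x, norm2 (Q x) = norm2 x) -> measurable A ->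
  m n (Q @^-1` A) = m n A.
Proof.
move=> mQ QD QK Qn mA.
have := @linear_change R n Q Q A (cball 0 1) mQ QD QK mA (measurable_cball _ _).
rewrite (_ : Q @^-1` cball 0 1 = cball 0 1); last first.
  by apply/seteqP; split=> x; rewrite /cball/= !subr0 Qn.
rewrite ball_volE muleC => H.
have v0 := ball_vol_gt0 n; have vN0 : ball_vol n != 0 by rewrite gt_eqF.
rewrite -[LHS]mule1 -[RHS]mule1 -(_ : (ball_vol n)%:E * (ball_vol n)^-1%:E = 1)%E.
  rewrite !muleA -H//.
  by move=> x; rewrite /cball/= !subr0 norm2N.
by rewrite -EFinM divff.
Qed.

(** Reflection in the hyperplane orthogonal to u; for u = 0 the coefficient is 0 and
    it is the identity. *)
Definition householder n (u x : 'rV[R]_n) : 'rV[R]_n :=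
  x - (2 * dot x u / dot u u) *: u.

Lemma householderD n (u x y : 'rV[R]_n) :
  householder u (x + y) = householder u x + householder u y.
Proof.
rewrite /householder dotDl mulrDr mulrDl scalerDl opprD.
by rewrite -!addrA; congr +%R; rewrite addrCA.
Qed.

Lemma dot_householder n (u x : 'rV[R]_n) :
  dot (householder u x) u = - dot x u.
Proof.
rewrite /householder -scaleNr dotDl dotZl.
have [u0|u0] := eqVneq (dot u u) 0; last by rewrite mulNr divfK//; ring.
have -> : u = 0 by exact: dot_eq0.
by rewrite -(scale0r 0) dotZr; ring.
Qed.

Lemma householderK n (u : 'rV[R]_n) : involutive (householder u).
Proof.
move=> x; rewrite {1}/householder dot_householder /householder.
by rewrite mulrN mulNr scaleNr opprK subrK.
Qed.

Lemma norm2_householder n (u x : 'rV[R]_n) : norm2 (householder u x) = norm2 x.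
Proof.
rewrite !norm2E; congr Num.sqrt.
rewrite {2}/householder -scaleNr dotDr dotZr dot_householder.
rewrite /householder -scaleNr dotDl dotZl (dotC u x); ring.
Qed.

Lemma householder_swap n (c d : 'rV[R]_n) : norm2 c = norm2 d ->
  householder (c - d) c = d.
Proof.
move=> cd; rewrite /householder.
have E : dot (c - d) (c - d) = 2 * dot c (c - d).
  rewrite -scaleN1r !(dotDl, dotDr, dotZl, dotZr).
  by rewrite (dotC d c) -!sqr_norm2 -cd; ring.
have [h|h] := eqVneq (dot (c - d) (c - d)) 0.
  have /dot_eq0/eqP := h; rewrite subr_eq0 => /eqP ->.
  by rewrite subrr scaler0 subr0.
by rewrite -E divff// scale1r opprB addrC subrK.
Qed.

Lemma measurable_householder n (u : 'rV[R]_n) :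
  measurable_fun setT (householder u).
Proof.
apply: measurable_rVB => //; apply: measurable_rVZ => //.
apply: measurable_funM => //; apply: measurable_funM => //.
apply: measurable_sum => i; apply: measurable_funM => //.
exact: measurable_rV_coord.
Qed.

(** The unit ball intersected with its translate by - c. *)
Definition lens n (c : 'rV[R]_n) : set 'rV[R]_n :=
  [set x | norm2 x <= 1 /\ norm2 (x + c) <= 1].

Lemma measurable_lens n (c : 'rV[R]_n) : measurable (lens c).
Proof.
by apply: measurableI; apply: measurable_le_set => //;
  apply: measurable_norm2_comp => //; exact: measurable_rVD.
Qed.

(** A reflection exchanges c and d, hence the two lenses. *)
Lemma lebesgue_lens n (c d : 'rV[R]_n) : norm2 c = norm2 d ->
  m n (lens c) = m n (lens d).
Proof.
move=> cd; rewrite -(@lebesgue_isometry n (householder (c - d)) (lens d)).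
- congr (m n _); apply/seteqP; split => x; rewrite /lens/= norm2_householder;
  by rewrite -{2}(householder_swap cd) -householderD norm2_householder.
- exact: measurable_householder.
- exact: householderD.
- exact: householderK.
- exact: norm2_householder.
- exact: measurable_lens.
Qed.

End volumes.
Arguments ball_vol {R} n.

(** * The volume of Psi as an integral of lens volumes *)

Section psi_volume.
Context {R : realType}.
Local Notation mu := (@lebesgue_measure R).
Local Notation m n := (@lebesgue_rV R n).
Local Open Scope ereal_scope.

Lemma measurable_row_mx n p d (T : measurableType d) (f : T -> 'rV[R]_n)
    (g : T -> 'rV[R]_p) : measurable_fun setT f -> measurable_fun setT g ->
  measurable_fun setT (fun x => row_mx (f x) (g x)).
Proof.
move=> mf mg; apply: measurable_fun_rV => i; case: (splitP i) => j ij.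
  rewrite (_ : _ \o _ = fun x => f x 0%R j); first exact: measurable_rV_coord_comp.
  apply/funext => x /=; rewrite /rV_coord (_ : i = lshift p j) ?row_mxEl//.
  exact: val_inj.
rewrite (_ : _ \o _ = fun x => g x 0%R j); first exact: measurable_rV_coord_comp.
apply/funext => x /=; rewrite /rV_coord (_ : i = rshift n j) ?row_mxEr//.
exact: val_inj.
Qed.

Lemma row_mx_cons n p (t : R) (x : 'rV[R]_n) (y : 'rV[R]_p) :
  row_mx (cons_rV (t, x) : 'rV[R]_n.+1) y
  = cons_rV (t, row_mx x y) :> 'rV[R]_(n + p).+1.
Proof.
apply/rowP => i.
pose z : 'rV[R]_n.+1 := cons_rV (t, x).
have zl (j : 'I_(n.+1 + p)) (k : 'I_n.+1) :
    j = k :> nat -> row_mx z y 0%R j = z 0%R k.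
  by move=> jk; rewrite (_ : j = lshift p k) ?row_mxEl//; exact: val_inj.
have zr (j : 'I_(n.+1 + p)) (k : 'I_p) :
    j = (n.+1 + k)%N :> nat -> row_mx z y 0%R j = y 0%R k.
  by move=> jk; rewrite (_ : j = rshift n.+1 k) ?row_mxEr//; exact: val_inj.
case: (unliftP 0%R i) => [j ->|->].
  rewrite [RHS]cons_rVS; case: (splitP j) => k jk.
    rewrite [LHS](zl _ (lift 0%R k)) ?cons_rVS//=; last by rewrite /= jk.
    by rewrite (_ : j = lshift p k) ?row_mxEl//; exact: val_inj.
  rewrite [LHS](zr _ k)/=; last by rewrite /= jk.
  by rewrite (_ : j = rshift n k) ?row_mxEr//; exact: val_inj.
by rewrite [RHS]cons_rV0 [LHS](zl _ 0%R)// cons_rV0.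
Qed.

(** The measure splits off one coordinate at a time; this splits R^(n + p) into its
    two factors. *)
Lemma integral_row_mx n p (h : 'rV[R]_(n + p) -> \bar R) :
  measurable_fun setT h -> (forall x, 0 <= h x) ->
  \int[m (n + p)]_z h z = \int[m n]_x \int[m p]_y h (row_mx x y).
Proof.
elim: n h => [|n IH] h mh h0.
  rewrite [RHS]integral_dirac// ?diracT ?mul1e; last first.
    apply: (measurable_fun_fubini_tonelli_F (fun p => h (row_mx p.1 p.2))) => //.
    by apply: measurableT_comp mh _; exact: measurable_row_mx.
  apply: eq_integral => y _; congr h; apply/rowP => i.
  case: (splitP i) => -[j hj]//= ij; rewrite (_ : i = rshift 0 (Ordinal hj)).
    by rewrite row_mxEr; congr (y _ _); exact: val_inj.
  exact: val_inj.
rewrite (@integral_cons R (n + p))// integral_cons; last 2 first.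
- apply: (measurable_fun_fubini_tonelli_F (fun p => h (row_mx p.1 p.2))) => //.
  by apply: measurableT_comp mh _; exact: measurable_row_mx.
- by move=> x; apply: integral_ge0.
apply: eq_integral => t _; rewrite IH//; last first.
  by apply: measurableT_comp mh _; exact: measurable_cons_rV_comp.
by apply: eq_integral => x _; apply: eq_integral => y _; rewrite row_mx_cons.
Qed.

Lemma integral_row_mx_set n p (A : set 'rV[R]_(n + p)) : measurable A ->
  m (n + p) A = \int[m n]_x \int[m p]_y (\1_A (row_mx x y) : R)%:E.
Proof.
move=> mA; rewrite -(integral_row_mx (h := fun z => (\1_A z)%:E))//; last first.
  exact: measurable_EFin_indic.
by rewrite integral_indic// setIT.
Qed.

Lemma measurable_Psi n (l : R) : measurable (Psi n l).
Proof.
have ml : measurable_fun setT (lsubmx : 'rV[R]_(n + n) -> 'rV[R]_n).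
  apply: measurable_fun_rV => i.
  rewrite (_ : _ \o _ = rV_coord (lshift n i)); first exact: measurable_rV_coord.
  by apply/funext => x; rewrite /rV_coord /= mxE.
have mr : measurable_fun setT (rsubmx : 'rV[R]_(n + n) -> 'rV[R]_n).
  apply: measurable_fun_rV => i.
  rewrite (_ : _ \o _ = rV_coord (rshift n i)); first exact: measurable_rV_coord.
  by apply/funext => x; rewrite /rV_coord /= mxE.
rewrite (_ : Psi n l = [set v | norm2 (lsubmx v) <= 1]%R `&`
  [set v | norm2 (rsubmx v) <= 1]%R `&`
  [set v | norm2 (lsubmx v - rsubmx v) <= l]%R); last first.
  by apply/seteqP; split => v; [case=> *; repeat split|case=> -[]].
apply: measurableI; [apply: measurableI|]; apply: measurable_le_set => //;
  apply: measurable_norm2_comp => //.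
exact: measurable_rVB.
Qed.

(** The substitution b = a + c turns the three conditions on (a, b) into a in lens c
    and |c| <= l, and Tonelli integrates a away. *)
Lemma lebesgue_Psi n (l : R) :
  m (n + n) (Psi n l) = \int[m n]_(c in cball 0%R l) m n (lens c).
Proof.
rewrite integral_row_mx_set; last exact: measurable_Psi.
(* p is the pair (a, c) *)
pose h (p : 'rV[R]_n * 'rV[R]_n) : \bar R :=
  (\1_(cball 0%R l) p.2)%:E * (\1_(lens p.2) p.1 : R)%:E.
have mh : measurable_fun setT h.
  apply: emeasurable_funM.
    exact: measurableT_comp (measurable_EFin_indic (measurable_cball _ _)) measurable_snd.
  rewrite (_ : (fun p => _) = fun p => (\1_([set p : 'rV[R]_n * 'rV[R]_n |
     (norm2 p.1 <= 1)%R] `&` [set p | (norm2 (p.1 + p.2) <= 1)%R]) p)%:E); last first.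
    by apply/funext => -[a b]; rewrite !indicE; congr (_%:R%:E); congr nat_of_bool.
  apply: measurable_EFin_indic; apply: measurableI; apply: measurable_le_set => //;
    apply: measurable_norm2_comp => //.
  exact: measurable_rVD.
transitivity (\int[m n]_a \int[m n]_c h (a, c)).
  apply: eq_integral => a _; rewrite -[LHS](integral_shift a)//; last first.
    apply: measurableT_comp (measurable_EFin_indic (@measurable_Psi n l)) _.
    exact: measurable_row_mx.
  apply: eq_integral => c _; rewrite /h/= -EFinM; congr EFin; rewrite !indicE -natrM mulnb.
  congr (_%:R); congr nat_of_bool.
  have E : Psi n l (row_mx a (c + a)%R) <->
      [/\ norm2 a <= 1, norm2 (c + a) <= 1 & norm2 c <= l]%R.
    by rewrite /Psi/= row_mxKl row_mxKr (norm2_distC a) addrK.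
  apply/idP/andP => [/set_mem/E[h1 h2 h3]|[/set_mem h1 /set_mem [h2 h3]]].
    split; apply/mem_set; rewrite /cball/= ?subr0//.
    by split=> //; rewrite addrC.
  apply/mem_set/E; split=> //; last by rewrite /cball/= subr0 in h1.
  by rewrite addrC.
rewrite fubini_tonelli//; last by move=> p; rewrite mule_ge0 ?EFin_indic_ge0.
rewrite [RHS]integral_mkcond; apply: eq_integral => c _.
rewrite /h/= (@ge0_integralZl _ _ _ (m n) _ measurableT (fun x => (\1_(lens c) x)%:E))//; last first.
  exact: measurable_EFin_indic (measurable_lens c).
rewrite integral_indic//; last exact: measurable_lens.
rewrite setIT patchE indicE; case: ifPn => _; by rewrite ?mul1e ?mul0e.
Qed.

Lemma measurable_vol_lens n : measurable_fun setT (fun c : 'rV[R]_n => m n (lens c)).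
Proof.
pose A := [set p : 'rV[R]_n * 'rV[R]_n | (norm2 p.2 <= 1)%R]
  `&` [set p | (norm2 (p.2 + p.1) <= 1)%R].
have mA : measurable A.
  apply: measurableI; apply: measurable_le_set => //;
    apply: measurable_norm2_comp => //.
  exact: measurable_rVD.
have := @measurable_fun_xsection _ _ _ _ R (m n) _ mA.
congr measurable_fun; apply/funext => c /=; congr (m n _).
by apply/seteqP; split=> x /=; rewrite /xsection/= inE.
Qed.

(** For |t| <= 1 the unit ball of R^(k+1) meets the hyperplane at height t in a ball
    of R^k of radius sqrt (1 - t^2); this is the volume of that slice in units of
    the unit ball of R^k. *)
Definition slice_profile (k : nat) (t : R) : R := (Num.sqrt (1 - t ^+ 2) ^+ k)%R.

Lemma continuous_slice_profile k : continuous (slice_profile k).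
Proof.
move=> t; apply: (@continuous_comp _ _ _ (fun t : R => Num.sqrt (1 - t ^+ 2)) (fun u => u ^+ k)%R).
  apply: (@continuous_comp _ _ _ (fun t : R => 1 - t ^+ 2)%R Num.sqrt).
    by apply: cvgB; [exact: cvg_cst|exact: exprn_continuous].
  exact: sqrt_continuous.
exact: exprn_continuous.
Qed.

Lemma slice_profile_ge0 k t : (0 <= slice_profile k t)%R.
Proof. by rewrite exprn_ge0// sqrtr_ge0. Qed.

(** The boolean says whether the endpoint s is included: a lens is cut into one
    closed and one open cap. *)
Definition ecap_integral k (b : bool) (s : R) : \bar R :=
  \int[mu]_(t in [set` Interval (BSide b s) (BRight 1%R)]) (slice_profile k t)%:E.

Lemma norm2_cons k (t : R) (y : 'rV[R]_k) :
  (norm2 (cons_rV (t, y)) ^+ 2 = t ^+ 2 + norm2 y ^+ 2)%R.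
Proof.
rewrite norm2_row_mx; congr (_ + _)%R.
by rewrite sqr_norm2 /dot big_ord1 mxE expr2.
Qed.

Lemma lebesgue_cap k (b : bool) (s : R) : (0 <= s)%R ->
  m k.+1 [set x | (norm2 x <= 1)%R /\ (if b then (s <= x 0 0)%R else (s < x 0 0)%R)]
  = (ball_vol k)%:E * ecap_integral k b s.
Proof.
move=> s0; set A := [set x | _].
have mA : measurable A.
  apply: measurableI; first by apply: measurable_le_set => //; exact: measurable_norm2_comp.
  case: b {A}; [apply: measurable_le_set => //|apply: measurable_lt_set => //];
    exact: measurable_rV_coord.
have v0 : 0 <= (ball_vol k : R)%:E by rewrite lee_fin ltW// ball_vol_gt0.
have w0 t : 0 <= (slice_profile k t)%:E by rewrite lee_fin slice_profile_ge0.
have mw D : measurable_fun D (fun t : measurableTypeR R => (slice_profile k t)%:E).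
  apply: measurable_funTS; apply/measurable_EFinP.
  exact: continuous_measurable_fun (@continuous_slice_profile k).
rewrite lebesgue_rVS /ecap_integral -ge0_integralZl//=.
rewrite /product_measure1 [RHS]integral_mkcond; apply: eq_integral => t _ /=.
rewrite patchE; case: ifPn => [|].
  rewrite inE/= in_itv/= => /andP[st t1].
  have t0 : (0 <= t)%R by case: (b) st => /=; [exact: le_trans|move/ltW; exact: le_trans].
  have u0 : (0 <= 1 - t ^+ 2)%R by rewrite subr_ge0 exprn_ile1.
  have E (y : 'rV[R]_k) :
      (norm2 y <= Num.sqrt (1 - t ^+ 2))%R = (norm2 (cons_rV (t, y)) <= 1)%R.
    rewrite -(ler_pXn2r (n := 2)) ?nnegrE ?norm2_ge0 ?sqrtr_ge0// [leRHS]sqr_sqrtr//.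
    by rewrite lerBrDl -norm2_cons expr_le1 ?norm2_ge0.
  rewrite muleC -EFinM -lebesgue_cball ?sqrtr_ge0//; congr (m k _).
  apply/seteqP; split => y; rewrite /xsection/= ?inE/= /A/= /cball/= ?subr0.
    by move=> [+ _]; rewrite E.
  by rewrite cons_rV0 E => h; split.
rewrite notin_setE/= in_itv/= => nt.
rewrite (_ : xsection _ _ = set0) ?measure0//.
apply/seteqP; split => // y; rewrite /xsection/= inE/= /A/= cons_rV0 => -[h1 h2].
apply: nt; apply/andP; split; first by move: h2; case: (b).
by rewrite -[t](cons_rV0 t y) (le_trans (ler_norm _))// (le_trans (coord_le_norm2 _ _)).
Qed.

Lemma ecap_integral_bool k s : ecap_integral k true s = ecap_integral k false s.
Proof.
rewrite /ecap_integral.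
have [s1|s1] := ltP s 1%R; last first.
  rewrite le_eqVlt in s1; case/predU1P: s1 => [<-|s1].
    by rewrite set_itv1 integral_set1 set_itvoc0 integral_set0.
  by rewrite !set_itv_ge ?integral_set0// bnd_simp -?leNgt -?ltNge// ltW.
rewrite integral_itv_obnd_cbnd//; apply: measurable_funTS; apply/measurable_EFinP.
exact: continuous_measurable_fun (@continuous_slice_profile k).
Qed.

End psi_volume.

Lemma integral_indicT d (T : measurableType d) (R : realType)
    (mu : {measure set T -> \bar R}) (A : set T) : measurable A ->
  (\int[mu]_x (\1_A x)%:E = mu A)%E.
Proof. by move=> mA; rewrite integral_indic// setIT. Qed.

Section lens_volume.
Context {R : realType}.
Local Notation mu := (@lebesgue_measure R).
Local Notation m n := (@lebesgue_rV R n).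

Definition cap_integral k (s : R) : R := \int[mu]_(t in `[s, 1]) slice_profile k t.

Lemma integrable_slice_profile k (a b : R) : mu.-integrable `[a, b] (EFin \o slice_profile k).
Proof.
apply: continuous_compact_integrable; first exact: segment_compact.
exact/continuous_subspaceT/continuous_slice_profile.
Qed.

Lemma ecap_integralE k b s : ecap_integral k b s = (cap_integral k s)%:E.
Proof.
have -> : ecap_integral k b s = ecap_integral k true s by case: b; rewrite ?ecap_integral_bool.
rewrite /cap_integral /Rintegral fineK//.
apply: integral_fune_fin_num => //; exact: (integrable_slice_profile k s 1).
Qed.

Lemma lebesgue_shift n (c : 'rV[R]_n) (A : set 'rV[R]_n) : measurable A ->
  m n ((fun x => x + c) @^-1` A) = m n A.
Proof.
move=> mA.
have := integral_shift c (h := fun x => (\1_A x)%:E) (measurable_EFin_indic mA) (fun x => EFin_indic_ge0 _ x).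
rewrite (integral_indicT _ mA) => <-; rewrite -[LHS]integral_indicT//.
by apply: measurable_preimage => //; exact: measurable_rVD.
Qed.

(** The hyperplane at equal distance from the two centres cuts the lens in two. On
    each side the condition on the farther centre implies the other one, so both
    parts are images of a cap at height s / 2, one under x |-> - x and one under a
    translation. *)
Lemma lebesgue_lens_cons k s : 0 <= s ->
  m k.+1 (lens (cons_rV (s, 0))) = (2 * ball_vol k * cap_integral k (s / 2))%:E.
Proof.
move=> s0; set c := cons_rV _.
(* x + c is no longer than x exactly when the first coordinate of x is at most - s / 2
   (for s > 0); this decides which of the two conditions is the stronger. *)
have c1 (x : 'rV[R]_k.+1) : norm2 (x + c) ^+ 2 = norm2 x ^+ 2 + 2 * s * x 0 0 + s ^+ 2.
  rewrite (cons_rVK x) cons_rVD !norm2_cons cons_rV0 addr0; ring.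
have norm_sq (x y : 'rV[R]_k.+1) : norm2 x ^+ 2 <= norm2 y ^+ 2 -> norm2 x <= norm2 y.
  by rewrite ler_pXn2r// nnegrE norm2_ge0.
pose D1 := [set x : 'rV[R]_k.+1 | x 0 0 < - (s / 2)].
pose D2 := [set x : 'rV[R]_k.+1 | - (s / 2) <= x 0 0].
have mD1 : measurable D1 by apply: measurable_lt_set => //; exact: measurable_rV_coord.
have mD2 : measurable D2 by apply: measurable_le_set => //; exact: measurable_rV_coord.
have mL := measurable_lens c.
have -> : lens c = (lens c `&` D1) `|` (lens c `&` D2).
  rewrite -setIUr; apply/esym/setIidPl => x _.
  by rewrite /D1/D2/=; case: ltP => _; [left|right].
have mcap (b : bool) : measurable [set x : 'rV[R]_k.+1 | norm2 x <= 1 /\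
    (if b then s / 2 <= x 0 0 else s / 2 < x 0 0)].
  apply: measurableI; first by apply: measurable_le_set => //; exact: measurable_norm2_comp.
  case: b; [apply: measurable_le_set => //|apply: measurable_lt_set => //];
    exact: measurable_rV_coord.
have s20 : 0 <= s / 2 by rewrite divr_ge0.
have Ecap (b : bool) := @lebesgue_cap R k b (s / 2) s20.
have E1 : (m k.+1 (lens c `&` D1) = (ball_vol k)%:E * ecap_integral k false (s / 2))%E.
  rewrite -Ecap (_ : lens c `&` D1 = -%R @^-1` [set x : 'rV[R]_k.+1 | norm2 x <= 1 /\ s / 2 < x 0 0]).
    apply: lebesgue_isometry; [exact: measurable_rVN|exact: opprD|exact: opprK
      |exact: norm2N|exact: (mcap false)].
  apply/seteqP; split => x; rewrite /lens/D1/= norm2N mxE ltrNr; first by move=> [[? _] ?].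
  move=> [x1 xs]; split=> //; split => //; apply: le_trans x1; apply: norm_sq.
  by rewrite c1; nra.
have E2 : (m k.+1 (lens c `&` D2) = (ball_vol k)%:E * ecap_integral k true (s / 2))%E.
  rewrite -Ecap (_ : lens c `&` D2 = (fun x => x + c) @^-1` [set x : 'rV[R]_k.+1 | norm2 x <= 1 /\ s / 2 <= x 0 0]).
    by apply: lebesgue_shift; exact: (mcap true).
  apply/seteqP; split => x; rewrite /lens/D2/= mxE cons_rV0.
    by move=> [[_ ?] ?]; split => //; lra.
  move=> [x1 xs]; split=> //; last by lra.
  split => //; apply: le_trans x1; apply: norm_sq.
  by rewrite c1; nra.
transitivity (m k.+1 (lens c `&` D1) + m k.+1 (lens c `&` D2))%E.
  rewrite measureU//; [exact: measurableI|exact: measurableI|].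
  by apply/seteqP; split => x // [[_ d1] [_ d2]]; move: d1 d2; rewrite /D1/D2/=; case: ltP.
rewrite E1 E2 !ecap_integralE -!EFinM -EFinD; congr EFin; ring.
Qed.

Lemma norm2_cons0 k (s : R) : 0 <= s -> norm2 (cons_rV (s, 0 : 'rV[R]_k)) = s.
Proof.
move=> s0; apply/eqP; rewrite -(eqrXn2 (n := 2)) ?norm2_ge0// norm2_cons norm20.
by rewrite expr0n addr0.
Qed.

(** The unit ball is the lens of two coinciding balls. *)
Lemma ball_vol_cap k : ball_vol k.+1 = 2 * ball_vol k * cap_integral k 0 :> R.
Proof.
apply: EFin_inj; rewrite -ball_volE -[X in cap_integral k X](mul0r 2^-1) -lebesgue_lens_cons//.
congr (m _ _); apply/seteqP; split => x; rewrite /cball/lens/= subr0.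
  rewrite (_ : cons_rV _ = 0) ?addr0//.
  by apply: norm2_eq0; rewrite norm2_cons0.
by case.
Qed.

(** The proportion of the unit ball of R^(k+1) that is covered by its translate by a
    vector of length s. *)
Definition overlap k (s : R) : R := cap_integral k (s / 2) / cap_integral k 0.

Lemma cap_integral0_gt0 k : 0 < cap_integral k 0.
Proof.
have := @ball_vol_gt0 R k.+1.
by rewrite ball_vol_cap pmulr_rgt0// mulr_gt0// ball_vol_gt0.
Qed.

Lemma cap_integral_ge0 k s : 0 <= cap_integral k s.
Proof. by apply: Rintegral_ge0 => t _; exact: slice_profile_ge0. Qed.

Lemma cap_integral_le k (s t : R) : s <= t -> cap_integral k t <= cap_integral k s.
Proof.
move=> st; rewrite -lee_fin -!(ecap_integralE k true); apply: ge0_subset_integral => //.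
- by apply: measurable_funTS; apply/measurable_EFinP; exact: continuous_measurable_fun (@continuous_slice_profile R k).
- by move=> x _; rewrite lee_fin slice_profile_ge0.
by apply: subset_itvr; rewrite bnd_simp.
Qed.

Lemma overlap_ge0 k s : 0 <= overlap k s.
Proof. by rewrite divr_ge0// cap_integral_ge0. Qed.

Lemma overlap_le k s t : s <= t -> overlap k t <= overlap k s.
Proof.
by move=> st; rewrite ler_pM2r ?invr_gt0 ?cap_integral0_gt0// cap_integral_le// ler_pM2r.
Qed.

Lemma overlap0 k : overlap k 0 = 1.
Proof. by rewrite /overlap mul0r divff// gt_eqF// cap_integral0_gt0. Qed.

Lemma lebesgue_lensE k (c : 'rV[R]_k.+1) :
  m k.+1 (lens c) = (ball_vol k.+1 * overlap k (norm2 c))%:E.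
Proof.
rewrite (@lebesgue_lens R k.+1 _ (cons_rV (norm2 c, 0))); last first.
  by rewrite norm2_cons0// norm2_ge0.
rewrite lebesgue_lens_cons ?norm2_ge0// ball_vol_cap /overlap; congr EFin.
by rewrite [RHS]mulrACA -!mulrA divff ?mulr1// gt_eqF// cap_integral0_gt0.
Qed.

(** The probability that two independent uniform points of the unit ball are at
    distance at most l. *)
Definition psi_ratio n (l : R) : R := fine (m (n + n) (Psi n l)) / ball_vol n ^+ 2.

Lemma lebesgue_Psi_fin n (l : R) : m (n + n) (Psi n l) \is a fin_num.
Proof.
rewrite ge0_fin_numE//; apply: (@le_lt_trans _ _ (m (n + n) (cube 1))).
  apply: le_measure; rewrite ?inE; [exact: measurable_Psi|exact: measurable_cube|].
  move=> v [h1 h2 _] i; rewrite -(hsubmxK v); case: (splitP i) => j ij.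
    rewrite (_ : i = lshift n j) ?row_mxEl; last exact: val_inj.
    exact: le_trans (coord_le_norm2 _ _) h1.
  rewrite (_ : i = rshift n j) ?row_mxEr; last exact: val_inj.
  exact: le_trans (coord_le_norm2 _ _) h2.
by rewrite lebesgue_cube// ltry.
Qed.

Lemma lebesgue_PsiE n (l : R) :
  (m (n + n) (Psi n l) / m n (cball 0 1) ^+ 2)%E = (psi_ratio n l)%:E.
Proof.
rewrite ball_volE -EFin_expe.
rewrite inver gt_eqF ?exprn_gt0 ?ball_vol_gt0//=.
by rewrite /psi_ratio EFinM fineK// lebesgue_Psi_fin.
Qed.

(** By the formula for the volume of Psi, the increment is the integral of the lens
    volume over the annulus s < |c| <= t. There the overlap lies between its values
    at t and at s, and the annulus has t ^ n - s ^ n times the volume of the ball. *)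
Lemma psi_ratio_sandwich k (s t : R) : 0 <= s <= t ->
  overlap k t * (t ^+ k.+1 - s ^+ k.+1) <= psi_ratio k.+1 t - psi_ratio k.+1 s
  <= overlap k s * (t ^+ k.+1 - s ^+ k.+1).
Proof.
move=> /andP[s0 st]; have t0 := le_trans s0 st.
set n := k.+1; have v0 := @ball_vol_gt0 R n.
pose A := cball 0 t `\` cball (0 : 'rV[R]_n) s.
have mA : measurable A by apply: measurableD; exact: measurable_cball.
have sub : cball (0 : 'rV[R]_n) s `<=` cball 0 t.
  by move=> x /= h; exact: le_trans h st.
have Avol : m n A = ((t ^+ n - s ^+ n) * ball_vol n)%:E.
  transitivity (m n (cball 0 t) - m n (cball 0 t `&` cball 0 s))%E.
    rewrite measureD//; [exact: measurable_cball|exact: measurable_cball|].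
    by apply: le_lt_trans (ltry (t ^+ n * ball_vol n)); rewrite -lebesgue_cball.
  rewrite (setIidr sub) !lebesgue_cball// -EFinB; congr EFin; ring.
have mlens D : measurable_fun D (fun c : 'rV[R]_n => m n (lens c)).
  by apply: measurable_funTS; exact: measurable_vol_lens.
have HE : (m (n + n) (Psi n t) = m (n + n) (Psi n s) + \int[m n]_(c in A) m n (lens c))%E.
  rewrite !lebesgue_Psi -ge0_integral_setU//; last 2 first.
  - exact: measurable_cball.
  - by apply/disj_setPS => x [? []].
  by rewrite setDUK.
set I := (\int[m n]_(c in A) m n (lens c))%E in HE.
have I1 : ((ball_vol n * overlap k t * ((t ^+ n - s ^+ n) * ball_vol n))%:E <= I)%E.
  rewrite EFinM -Avol -integral_cst//; apply: ge0_le_integral => //.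
  - by move=> x _; rewrite lee_fin mulr_ge0 ?overlap_ge0 ?ltW.
  - move=> x [xt _]; rewrite /cball/= subr0 in xt.
    by rewrite lebesgue_lensE lee_fin ler_pM2l// overlap_le.
have I2 : (I <= (ball_vol n * overlap k s * ((t ^+ n - s ^+ n) * ball_vol n))%:E)%E.
  rewrite EFinM -Avol -integral_cst//; apply: ge0_le_integral => //.
  move=> x [_ xs]; rewrite /cball/= subr0 in xs; move/negP: xs; rewrite -ltNge => xs.
  by rewrite lebesgue_lensE lee_fin ler_pM2l// overlap_le// ltW.
have If : I \is a fin_num.
  rewrite fin_numE; apply/andP; split.
    by apply/negP => /eqP E; move: I1; rewrite E leeNy_eq.
  by apply/negP => /eqP E; move: I2; rewrite E leye_eq.
rewrite -(fineK If) !lee_fin in I1 I2.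
have -> : psi_ratio n t - psi_ratio n s = fine I / ball_vol n ^+ 2.
  rewrite /psi_ratio HE fineD ?lebesgue_Psi_fin//; lra.
rewrite ler_pdivlMr ?ler_pdivrMr ?exprn_gt0//; apply/andP; split.
  apply: le_trans I1; rewrite le_eqVlt; apply/orP; left; apply/eqP; ring.
apply: le_trans I2 _; rewrite le_eqVlt; apply/orP; left; apply/eqP; ring.
Qed.

Lemma psi_ratio0 k : psi_ratio k.+1 0 = 0.
Proof.
rewrite /psi_ratio lebesgue_Psi null_set_integral ?mul0r//.
- exact: measurable_cball.
- by apply: measurable_funTS; exact: measurable_vol_lens.
by apply: etrans (lebesgue_cball _ (lexx 0)) _; rewrite expr0n mul0r.
Qed.

Lemma psi_ratio_ge2 n (l : R) : 2 <= l -> psi_ratio n l = 1.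
Proof.
move=> l2; rewrite /psi_ratio integral_row_mx_set; last exact: measurable_Psi.
rewrite (_ : (\int[_]_x _)%E = (ball_vol n ^+ 2)%:E).
  by rewrite divff// expf_neq0// gt_eqF// ball_vol_gt0.
have ib : (\int[m n]_y (\1_(cball 0 1) y : R)%:E = (ball_vol n)%:E)%E.
  exact: etrans (integral_indicT _ (measurable_cball _ _)) (ball_volE n).
transitivity (\int[m n]_x ((ball_vol n)%:E * (\1_(cball 0 1) x : R)%:E))%E.
  apply: eq_integral => x _.
  transitivity (\int[m n]_y ((\1_(cball 0 1) x : R)%:E * (\1_(cball 0 1) y : R)%:E))%E.
    apply: eq_integral => y _; rewrite -EFinM !indicE -natrM mulnb; congr (_%:R%:E).
    congr nat_of_bool; apply/idP/andP => [/set_mem[]|[/set_mem h1 /set_mem h2]].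
      rewrite row_mxKl row_mxKr => h1 h2 _.
      by split; apply/mem_set; rewrite /cball/= subr0.
    rewrite /cball/= !subr0 in h1 h2; apply/mem_set; split; rewrite ?row_mxKl ?row_mxKr//.
    by apply: le_trans (ler_norm2B _ _) _; lra.
  rewrite ge0_integralZl//; last exact: measurable_EFin_indic (measurable_cball _ _).
  by rewrite ib muleC.
rewrite ge0_integralZl//; last 2 first.
- exact: measurable_EFin_indic (measurable_cball _ _).
- by rewrite lee_fin ltW// ball_vol_gt0.
by rewrite ib -EFinM -expr2.
Qed.

Lemma psi_ratio_lt0 n (l : R) : l < 0 -> psi_ratio n l = 0.
Proof.
move=> l0; rewrite /psi_ratio (_ : Psi n l = set0) ?measure0 ?mul0r//.
apply/seteqP; split => // v [_ _] h; have := le_lt_trans h l0.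
by rewrite ltNge norm2_ge0.
Qed.

End lens_volume.

(** * Incomplete beta functions as cap integrals *)

Section substitution.
Context {R : realType}.
Local Notation mu := (@lebesgue_measure R).
Implicit Types (p : {poly R}) (G : R -> R).

Lemma derivable_oo_LRcontinuous_horner p a b :
  derivable_oo_LRcontinuous (horner p) a b.
Proof.
split.
- by move=> x _; exact: derivable_horner.
- by apply: cvg_at_right_filter; exact: continuous_horner.
- by apply: cvg_at_left_filter; exact: continuous_horner.
Qed.

(** Substitution along a polynomial, for which differentiability and continuity of
    the derivative are automatic. *)
Lemma Rintegral_subst_incr p a b G : a <= b ->
  {in `[a, b] &, {homo horner p : x y / x < y}} ->
  {within `[p.[a], p.[b]], continuous G} ->
  \int[mu]_(x in `[p.[a], p.[b]]) G x =
  \int[mu]_(x in `[a, b]) (G p.[x] * (deriv p).[x]).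
Proof.
move=> ab mono cG; rewrite /Rintegral; congr fine.
rewrite integration_by_substitution_increasing//= -?derivE//.
- by move=> x _; exact: continuous_horner.
- by apply/cvg_ex; eexists; apply: cvg_at_right_filter; exact: continuous_horner.
- by apply/cvg_ex; eexists; apply: cvg_at_left_filter; exact: continuous_horner.
- exact: derivable_oo_LRcontinuous_horner.
Qed.

Lemma Rintegral_subst_decr p a b G : a <= b ->
  {in `[a, b] &, {homo horner p : x y /~ x < y}} ->
  {within `[p.[b], p.[a]], continuous G} ->
  \int[mu]_(x in `[p.[b], p.[a]]) G x =
  \int[mu]_(x in `[a, b]) (G p.[x] * - (deriv p).[x]).
Proof.
move=> ab mono cG; rewrite /Rintegral; congr fine.
rewrite integration_by_substitution_decreasing//= -?derivE//.
- by move=> x _; exact: continuous_horner.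
- by apply/cvg_ex; eexists; apply: cvg_at_right_filter; exact: continuous_horner.
- by apply/cvg_ex; eexists; apply: cvg_at_left_filter; exact: continuous_horner.
- exact: derivable_oo_LRcontinuous_horner.
Qed.

End substitution.

Section beta_integrals.
Context {R : realType}.
Local Notation mu := (@lebesgue_measure R).
Variable k : nat.
Local Notation J := (@cap_integral R k).

Lemma integrable_cts (f : R -> R) a b : continuous f -> mu.-integrable `[a, b] (EFin \o f).
Proof.
move=> cf; apply: continuous_compact_integrable; first exact: segment_compact.
exact: continuous_subspaceT.
Qed.

Lemma RintegralZl_cts (f : R -> R) r a b : continuous f ->
  \int[mu]_(x in `[a, b]) (r * f x) = r * \int[mu]_(x in `[a, b]) f x.
Proof. by move=> cf; rewrite RintegralZl//; exact: integrable_cts. Qed.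

Lemma Rintegral_split (f : R -> R) (a b c : R) : continuous f -> a <= b <= c ->
  \int[mu]_(x in `[a, c]) f x =
  \int[mu]_(x in `[a, b]) f x + \int[mu]_(x in `[b, c]) f x.
Proof.
move=> cf /andP[ab bc].
have := @Rintegral_itvB _ f (BLeft a) (BRight c) b (integrable_cts a c cf).
rewrite !bnd_simp => /(_ ab bc) E; apply/eqP; rewrite addrC -subr_eq E; apply/eqP.
rewrite Rintegral_itv_obnd_cbnd//; apply: integrableS (integrable_cts b c cf) => //.
by apply: subset_itvr; rewrite bnd_simp.
Qed.

Lemma powR_half (u : R) : 0 <= u -> u `^ (k.+2%:R / 2 - 1) = Num.sqrt u ^+ k.
Proof.
move=> u0; rewrite (_ : _ - 1 = 2^-1 * k%:R); last by rewrite -addn2 natrD; field.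
by rewrite powRrM powR12_sqrt// powR_mulrn// sqrtr_ge0.
Qed.

Lemma powR_mhalf (u : R) : 0 <= u -> u `^ (1 / 2 - 1) = (Num.sqrt u)^-1.
Proof.
move=> u0; rewrite (_ : _ - 1 = - 2^-1); last by lra.
by rewrite powRN powR12_sqrt.
Qed.

(** The integrand of the incomplete beta function with parameters (k + 2) / 2 and
    1 / 2, written with square roots. *)
Definition cap_dens (u : R) : R := Num.sqrt u ^+ k / Num.sqrt (1 - u).

Lemma inc_beta_capE x : x <= 1 ->
  inc_beta x (k.+2%:R / 2) (1 / 2) = \int[mu]_(u in `[0, x]) cap_dens u.
Proof.
move=> x1; apply: eq_Rintegral => u; rewrite inE/= in_itv/= => /andP[u0 ux].
by rewrite powR_half// powR_mhalf// subr_ge0 (le_trans ux).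
Qed.

Lemma continuous_sqrt_onem : continuous (fun u : R => Num.sqrt (1 - u)).
Proof.
move=> u; apply: (@continuous_comp _ _ _ (fun u : R => 1 - u) Num.sqrt).
  by apply: cvgB; [exact: cvg_cst|exact: cvg_id].
exact: sqrt_continuous.
Qed.

Lemma continuous_sqrtX : continuous (fun u : R => Num.sqrt u ^+ k).
Proof.
move=> u; apply: (@continuous_comp _ _ _ Num.sqrt (fun v : R => v ^+ k)).
  exact: sqrt_continuous.
exact: exprn_continuous.
Qed.

(** The substitution u = 1 - x ^ 2. *)
Lemma Rintegral_cap_dens (y : R) : 0 < y <= 1 ->
  \int[mu]_(u in `[0, 1 - y ^+ 2]) cap_dens u = 2 * J y.
Proof.
move=> /andP[y0 y1].
pose p : {poly R} := 1 - 'X^2.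
have pE x : p.[x] = 1 - x ^+ 2 by rewrite /p !hornerE.
have p1 : p.[1] = 0 by rewrite pE; ring.
have p'E x : (deriv p).[x] = - (2 * x).
  by rewrite /p derivB derivXn derivC !hornerE/=; ring.
rewrite -p1 -pE Rintegral_subst_decr//.
- rewrite /cap_integral -RintegralZl//; last exact: integrable_slice_profile.
  apply: eq_Rintegral => x; rewrite inE/= in_itv/= => /andP[yx x1].
  have x0 : 0 < x by exact: lt_le_trans yx.
  rewrite /cap_dens /slice_profile pE p'E (_ : 1 - (1 - x ^+ 2) = x ^+ 2); last by ring.
  rewrite sqrtr_sqr gtr0_norm//.
  by field; rewrite gt_eqF.
- move=> a b; rewrite !in_itv/= => /andP[ya a1] /andP[yb b1] ba.
  by rewrite !pE ltrD2l ltrN2 ltr_pXn2r// nnegrE; lra.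
- rewrite p1 pE; apply: continuous_in_subspaceT => u.
  rewrite inE/= in_itv/= => /andP[u0 u1].
  apply: cvgM; first exact: continuous_sqrtX.
  apply: cvgV; last exact: continuous_sqrt_onem.
  by rewrite gt_eqF// sqrtr_gt0; have := exprn_gt0 2 y0; lra.
Qed.

Lemma slice_profile_le1 (x : R) : slice_profile k x <= 1.
Proof.
by apply: exprn_ile1; rewrite ?sqrtr_ge0// -sqrtr1 ler_wsqrtr// sqrtr1 gerBl sqr_ge0.
Qed.

Lemma Rintegral_le_cts (f g : R -> R) a b : continuous f -> continuous g ->
  (forall x, a <= x <= b -> f x <= g x) ->
  \int[mu]_(x in `[a, b]) f x <= \int[mu]_(x in `[a, b]) g x.
Proof.
move=> cf cg fg.
have iF := integrable_cts a b cf; have iG := integrable_cts a b cg.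
exact: le_Rintegral.
Qed.

Lemma Rintegral_cst_itv (r a b : R) : a <= b ->
  \int[mu]_(x in `[a, b]) r = r * (b - a).
Proof.
move=> ab; rewrite Rintegral_cst//= lebesgue_measure_itv/= lte_fin.
by move: ab; rewrite le_eqVlt => /predU1P[->|->//]; rewrite ltxx/= subrr.
Qed.

Lemma cap_integral_near0 (y : R) : 0 <= y <= 1 -> J 0 - y <= J y <= J 0.
Proof.
move=> /andP[y0 y1]; rewrite cap_integral_le// andbT.
rewrite /cap_integral (@Rintegral_split _ 0 y 1) ?y0//; last exact: continuous_slice_profile.
rewrite lerBlDr addrC lerD2l -[leRHS]subr0 -[leRHS]mul1r -Rintegral_cst_itv//.
apply: Rintegral_le_cts; [exact: continuous_slice_profile|exact: cst_continuous|].
by move=> x _; exact: slice_profile_le1.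
Qed.

Lemma measurable_cap_dens : measurable_fun setT (cap_dens : measurableTypeR R -> R).
Proof.
rewrite (_ : cap_dens = fun u => Num.sqrt u ^+ k * Num.sqrt (1 - u) `^ (-1)).
  apply: measurable_funM.
    exact: continuous_measurable_fun continuous_sqrtX.
  apply: measurableT_comp (measurable_powR _) _.
  exact: continuous_measurable_fun continuous_sqrt_onem.
by apply/funext => u; rewrite powR_inv1// sqrtr_ge0.
Qed.

Lemma integral_cap_dens (y : R) : 0 < y <= 1 ->
  (\int[mu]_(u in `[0%R, (1 - y ^+ 2)%R]) (cap_dens u)%:E = (2 * J y)%:E)%E.
Proof.
move=> y01; rewrite -Rintegral_cap_dens// /Rintegral fineK//.
apply: integral_fune_fin_num => //.
apply: continuous_compact_integrable; first exact: segment_compact.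
apply: continuous_in_subspaceT => u.
rewrite inE/= in_itv/= => /andP[u0 u1]; case/andP: y01 => y0 y1.
apply: cvgM; first exact: continuous_sqrtX.
apply: cvgV; last exact: continuous_sqrt_onem.
by rewrite gt_eqF// sqrtr_gt0; have := exprn_gt0 2 y0; lra.
Qed.

(** The integrand blows up at 1, where the substitution does not apply. The
    intervals [0, 1 - y ^ 2] exhaust [0, 1[ as y tends to 0, and monotone convergence
    gives the value. *)
Lemma Rintegral_cap_dens0 :
  \int[mu]_(u in `[0, 1]) cap_dens u = 2 * J 0.
Proof.
pose y (i : nat) : R := i.+1%:R^-1.
have y0 i : 0 < y i by rewrite invr_gt0.
have y1 i : y i <= 1 by rewrite invf_le1// ler1n.
pose F (i : nat) : set (measurableTypeR R) := `[0, 1 - y i ^+ 2]%classic.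
have mcd D : measurable_fun D (fun u : measurableTypeR R => (cap_dens u)%:E).
  by apply: measurable_funTS; apply/measurable_EFinP; exact: measurable_cap_dens.
have ndF : nondecreasing_seq F.
  move=> i j ij; apply/subsetPset; apply: subset_itvl; rewrite bnd_simp.
  rewrite lerD2l lerN2 ler_pXn2r// ?nnegrE ?(ltW (y0 _))// /y lef_pV2 ?posrE//.
  by rewrite ler_nat.
have cd0 u : (0 <= (cap_dens u)%:E)%E.
  by rewrite lee_fin divr_ge0// ?exprn_ge0 ?sqrtr_ge0.
have := @ge0_nondecreasing_set_cvg_integral _ _ R F
  (fun u => (cap_dens u)%:E) mu ndF (fun i => measurable_itv _) (fun i => mcd _)
  (fun _ u _ => cd0 u).
rewrite (_ : \bigcup_i F i = `[0, 1[%classic); last first.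
  apply/seteqP; split => u /=.
    move=> [i _]; rewrite /F/= !in_itv/= => /andP[-> /=] /le_lt_trans; apply.
    by rewrite gtrBl exprn_gt0.
  rewrite in_itv/= => /andP[u0 u1].
  have [i hi] := ltr_add_invr u1; exists i => //; rewrite /F/= in_itv/= u0/=.
  rewrite -/(y i) in hi; have := y1 i; have := y0 i; nra.
under eq_fun do rewrite integral_cap_dens ?y0 ?y1//.
rewrite (integral_itv_bndo_bndc (mcd _)).
move=> lim1; rewrite /Rintegral.
have lim2 : (2 * J (y i))%:E @[i --> \oo] --> (2 * J 0)%:E.
  apply: cvg_EFin; first exact: nearW.
  apply: cvgMr; apply: (@squeeze_cvgr _ _ _ _ (fun i => J 0 - y i) (fun=> J 0)).
  - by apply: nearW => i; apply: cap_integral_near0; rewrite y1 ltW.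
  - rewrite -[X in _ --> X]subr0; apply: cvgB; first exact: cvg_cst.
    exact: cvg_harmonic.
  - exact: cvg_cst.
have <- := cvg_lim (@ereal_hausdorff R) lim1.
by rewrite (cvg_lim (@ereal_hausdorff R) lim2).
Qed.

Lemma inc_beta_cap (y : R) : 0 <= y <= 1 ->
  inc_beta (1 - y ^+ 2) (k.+2%:R / 2) (1 / 2) = 2 * J y.
Proof.
move=> /andP[y0 y1]; rewrite inc_beta_capE; last by rewrite gerBl sqr_ge0.
move: y0; rewrite le_eqVlt => /predU1P[<-|y0]; last by rewrite Rintegral_cap_dens// y0.
by rewrite expr0n subr0 Rintegral_cap_dens0.
Qed.

Lemma beta_cap : beta (k.+2%:R / 2) (1 / 2) = 2 * J 0.
Proof.
by rewrite /beta -[X in inc_beta X](_ : 1 - 0 ^+ 2 = 1) ?inc_beta_cap ?lexx ?ler01// expr0n subr0.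
Qed.

(** This is where the density P_n acquires its geometric meaning. *)
Lemma reg_beta_overlap (l : R) : 0 <= l <= 2 ->
  reg_beta (1 - l ^+ 2 / 4) (k.+2%:R / 2) (1 / 2) = overlap k l.
Proof.
move=> /andP[l0 l2]; rewrite /reg_beta beta_cap (_ : l ^+ 2 / 4 = (l / 2) ^+ 2); last by field.
rewrite inc_beta_cap; last by apply/andP; split; lra.
by rewrite /overlap -mulf_div divff ?mul1r.
Qed.

Definition half_profile (x : R) : R := slice_profile k (x / 2).

Lemma continuous_half_profile : continuous half_profile.
Proof.
move=> x; apply: (@continuous_comp _ _ _ (fun x : R => x / 2) (slice_profile k)).
  by apply: cvgM; [exact: cvg_id|exact: cvg_cst].
exact: continuous_slice_profile.
Qed.

(** The substitution by x / 2 puts the caps on the same interval as the second term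
    of F_n. *)
Lemma cap_integral_half (s t : R) : 0 <= s <= t -> t <= 2 ->
  2 * (J (s / 2) - J (t / 2)) = \int[mu]_(x in `[s, t]) half_profile x.
Proof.
move=> /andP[s0 st] t2.
rewrite /cap_integral (@Rintegral_split _ (s / 2) (t / 2) 1); [|exact: continuous_slice_profile|]; last first.
  by apply/andP; split; lra.
rewrite addrK.
pose p : {poly R} := 2^-1 *: 'X.
have pE x : p.[x] = x / 2 by rewrite /p !hornerE mulrC.
rewrite -!pE Rintegral_subst_incr//.
- rewrite -RintegralZl_cts; last first.
    move=> x; apply: cvgM.
      apply: (@continuous_comp _ _ _ (horner p) (slice_profile k)); first exact: continuous_horner.
      exact: continuous_slice_profile.
    exact: continuous_horner.
  apply: eq_Rintegral => x _; rewrite /half_profile pE /p derivZ derivX !hornerE /=.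
  by field.
- by move=> x y _ _ xy; rewrite !pE ltr_pM2r.
- exact/continuous_subspaceT/continuous_slice_profile.
Qed.

(** The second term of F_n after the substitution u = x ^ 2 / 4. *)
Definition moment (l : R) : R := \int[mu]_(x in `[0, l]) (x ^+ k.+1 * half_profile x).

Lemma continuous_moment_dens : continuous (fun x : R => x ^+ k.+1 * half_profile x).
Proof. by move=> x; apply: cvgM; [exact: exprn_continuous|exact: continuous_half_profile]. Qed.

Lemma inc_beta_moment (l : R) : 0 <= l <= 2 ->
  2 ^+ k.+1 * inc_beta (l ^+ 2 / 4) (k.+2%:R / 2) (k.+2%:R / 2) = moment l.
Proof.
move=> /andP[l0 l2].
pose p : {poly R} := 4^-1 *: 'X^2.
have pE x : p.[x] = x ^+ 2 / 4 by rewrite /p hornerZ hornerXn mulrC.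
have p0 : p.[0] = 0 by rewrite pE expr0n mul0r.
have c2 : continuous (fun u : R => Num.sqrt u ^+ k * Num.sqrt (1 - u) ^+ k).
  move=> u; apply: cvgM; first exact: continuous_sqrtX.
  apply: (@continuous_comp _ _ _ (fun u : R => Num.sqrt (1 - u)) (fun v : R => v ^+ k)).
    exact: continuous_sqrt_onem.
  exact: exprn_continuous.
have -> : inc_beta (l ^+ 2 / 4) (k.+2%:R / 2) (k.+2%:R / 2) =
    \int[mu]_(u in `[p.[0], p.[l]]) (Num.sqrt u ^+ k * Num.sqrt (1 - u) ^+ k).
  rewrite p0 pE; apply: eq_Rintegral => u; rewrite inE/= in_itv/= => /andP[u0 ul].
  by rewrite !powR_half//; nra.
rewrite Rintegral_subst_incr//; last 2 first.
- move=> x y; rewrite !in_itv/= !pE => /andP[x0 _] /andP[y0 _] xy.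
  by rewrite ltr_pM2r// ltr_pXn2r.
- exact: continuous_subspaceT.
rewrite -RintegralZl_cts; last first.
  move=> x; apply: cvgM; last exact: continuous_horner.
  apply: (@continuous_comp _ _ _ (horner p)
    (fun u : R => Num.sqrt u ^+ k * Num.sqrt (1 - u) ^+ k)).
    exact: continuous_horner.
  exact: c2.
apply: eq_Rintegral => x; rewrite inE/= in_itv/= => /andP[x0 xl].
rewrite pE /p derivZ derivXn !hornerE/= /half_profile /slice_profile.
rewrite (_ : x ^+ 2 / 4 = (x / 2) ^+ 2); last by field.
rewrite sqrtr_sqr ger0_norm ?divr_ge0// expr_div_n !exprS.
have := exprn_gt0 k (ltr0n R 2) => /lt0r_neq0 h; field.
by rewrite h.
Qed.

Lemma F_cap_moment (l : R) : 0 <= l <= 2 ->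
  F_ k.+1 l = (2 * l ^+ k.+1 * J (l / 2) + moment l) / (2 * J 0).
Proof.
move=> l02; rewrite /F_ beta_cap inc_beta_moment// mulrC; congr ((_ + _) / _).
case/andP: l02 => l0 l2; rewrite (_ : l ^+ 2 / 4 = (l / 2) ^+ 2); last by field.
by rewrite inc_beta_cap; [ring|apply/andP; split; lra].
Qed.

(** With J for the cap integral, 2 (J (s / 2) - J (t / 2)) and the increment of the
    moment are the integrals over [s, t] of half_profile x and of
    x ^ (k + 1) * half_profile x. Both bounds then reduce to
    s ^ (k + 1) <= x ^ (k + 1) <= t ^ (k + 1). *)
Lemma F_sandwich (s t : R) : 0 <= s <= t -> t <= 2 ->
  overlap k t * (t ^+ k.+1 - s ^+ k.+1) <= F_ k.+1 t - F_ k.+1 s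
  <= overlap k s * (t ^+ k.+1 - s ^+ k.+1).
Proof.
move=> /andP[s0 st] t2; have J0 := @cap_integral0_gt0 R k.
rewrite !F_cap_moment; [|apply/andP; split; lra|apply/andP; split; lra].
have E := @cap_integral_half s t; rewrite s0 st t2 in E; have {}E := E isT isT.
have M : moment t = moment s + \int[mu]_(x in `[s, t]) (x ^+ k.+1 * half_profile x).
  by rewrite /moment (@Rintegral_split _ 0 s t) ?s0//; exact: continuous_moment_dens.
set I := \int[mu]_(x in `[s, t]) (x ^+ k.+1 * half_profile x) in M.
have I1 : s ^+ k.+1 * (2 * (J (s / 2) - J (t / 2))) <= I.
  rewrite E -RintegralZl_cts; last exact: continuous_half_profile.
  apply: Rintegral_le_cts.
  - by move=> x; apply: cvgM; [exact: cvg_cst|exact: continuous_half_profile].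
  - exact: continuous_moment_dens.
  - move=> x /andP[sx xt]; rewrite ler_wpM2r ?slice_profile_ge0// ler_pXn2r// nnegrE//.
    exact: le_trans sx.
have I2 : I <= t ^+ k.+1 * (2 * (J (s / 2) - J (t / 2))).
  rewrite E -RintegralZl_cts; last exact: continuous_half_profile.
  apply: Rintegral_le_cts.
  - exact: continuous_moment_dens.
  - by move=> x; apply: cvgM; [exact: cvg_cst|exact: continuous_half_profile].
  - move=> x /andP[sx xt]; rewrite ler_wpM2r ?slice_profile_ge0// ler_pXn2r// nnegrE//.
      exact: le_trans sx.
    exact: le_trans st.
rewrite M /overlap -mulrBl -[_ / J 0 * _]mulrAC -[_ / J 0 * _]mulrAC.
rewrite invfM !mulrA !ler_pM2r ?invr_gt0// ler_pdivlMr// ler_pdivrMr//.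
by apply/andP; split; lra.
Qed.

Lemma F_0 : F_ k.+1 0 = 0 :> R.
Proof.
rewrite F_cap_moment ?lexx ?ler0n// /moment set_itv1 Rintegral_set1.
by rewrite expr0n mulr0 mul0r addr0 mul0r.
Qed.

End beta_integrals.

(** * Identification of F_n and of the distribution function *)

Section sandwich.
Context {R : realType}.
Local Notation mu := (@lebesgue_measure R).

(** When D is nonincreasing, this says that X is the integral of D against
    d(x ^ n) on [0, 2], up to an additive constant. *)
Definition sandwiched (D X : R -> R) n := forall s t : R, 0 <= s <= t -> t <= 2 ->
  D t * (t ^+ n - s ^+ n) <= X t - X s <= D s * (t ^+ n - s ^+ n).

Lemma exprB_le n (s t : R) : 0 <= s <= t -> t <= 2 ->
  0 <= t ^+ n - s ^+ n <= n%:R * 2 ^+ n * (t - s).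
Proof.
move=> /andP[s0 st] t2; apply/andP; split.
  by rewrite subr_ge0 lerXn2r// nnegrE// (le_trans s0).
elim: n => [|n IH]; first by rewrite !expr0 subrr !mul0r.
have h1 : 0 <= t ^+ n - s ^+ n by rewrite subr_ge0 lerXn2r// nnegrE// (le_trans s0).
have h2 : s ^+ n <= 2 ^+ n by rewrite lerXn2r ?nnegrE//; lra.
have h3 : 0 <= 2 ^+ n :> R by exact: exprn_ge0.
have -> : t ^+ n.+1 - s ^+ n.+1 = t * (t ^+ n - s ^+ n) + s ^+ n * (t - s).
  by rewrite !exprS; ring.
rewrite -natr1 exprS.
have : t * (t ^+ n - s ^+ n) <= 2 * (n%:R * 2 ^+ n * (t - s)) by apply: ler_pM => //; lra.
have : s ^+ n * (t - s) <= 2 ^+ n * (t - s) by rewrite ler_wpM2r// subr_ge0.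
have : 0 <= 2 ^+ n * (t - s) by rewrite mulr_ge0// subr_ge0.
lra.
Qed.

Lemma dist_increments (a b c d p q w : R) : p * w <= a - b <= q * w ->
  p * w <= c - d <= q * w -> `|(a - c) - (b - d)| <= (q - p) * w.
Proof.
move=> /andP[h1 h2] /andP[h3 h4]; rewrite mulrBl.
by rewrite ler_norml; apply/andP; split; lra.
Qed.

(** Over each part of a subdivision of [0, l] into N equal parts, the increments of X
    and Y differ by at most (D s - D t) (t ^ n - s ^ n). The second factor is O(1 / N)
    and the first ones telescope, so X l and Y l differ by O(1 / N). *)
Lemma sandwiched_unique (D X Y : R -> R) n (l : R) :
  (forall s t, s <= t -> D t <= D s) ->
  sandwiched D X n -> sandwiched D Y n -> X 0 = Y 0 -> 0 <= l <= 2 ->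
  X l = Y l.
Proof.
move=> Dle hX hY XY0 /andP[l0 l2].
pose E x := X x - Y x.
have E0 : E 0 = 0 by rewrite /E XY0 subrr.
pose C : R := n%:R * 2 ^+ n * l.
suff H N : `|E l| <= (D 0 - D l) * C / N.+1%:R.
  apply/eqP; rewrite -subr_eq0 -normr_le0 -/(E l) leNgt; apply/negP => El0.
  have K0 : 0 <= (D 0 - D l) * C.
    have := H 0%N; rewrite divr1; exact: le_trans.
  pose N := Num.bound ((D 0 - D l) * C / `|E l|).
  have := H N; rewrite leNgt => /negP; apply.
  rewrite ltr_pdivrMr// [ltRHS]mulrC -ltr_pdivrMr//.
  have : 0 <= (D 0 - D l) * C / `|E l| by rewrite divr_ge0.
  by move=> /archi_boundP/lt_trans; apply; rewrite ltr_nat.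
pose t (i : nat) : R := l * i%:R / N.+1%:R.
have tN : t N.+1 = l by rewrite /t mulfK.
have t0 : t 0%N = 0 by rewrite /t mulr0 mul0r.
have tS i : t i.+1 - t i = l / N.+1%:R by rewrite /t -natr1; ring.
have dl : 0 <= l / N.+1%:R by rewrite divr_ge0.
have tle i : t i <= t i.+1 by rewrite -subr_ge0 tS.
have tge0 i : 0 <= t i by rewrite /t divr_ge0// mulr_ge0.
have tl i : (i <= N.+1)%N -> t i <= l.
  by move=> iN; rewrite /t -mulrA ler_piMr// ler_pdivrMr// mul1r ler_nat.
have step i : (i < N.+1)%N ->
    `|E (t i.+1) - E (t i)| <= (D (t i) - D (t i.+1)) * (C / N.+1%:R).
  move=> iN.
  have h1 : 0 <= t i <= t i.+1 by rewrite tge0 tle.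
  have h2 : t i.+1 <= 2 by rewrite (le_trans (tl _ iN)).
  have /andP[e1 e2] := exprB_le n h1 h2; rewrite tS mulrA in e2.
  have D0 : 0 <= D (t i) - D (t i.+1) by rewrite subr_ge0 Dle.
  apply: (@le_trans _ _ ((D (t i) - D (t i.+1)) * (t i.+1 ^+ n - t i ^+ n))).
    exact: dist_increments (hX _ _ h1 h2) (hY _ _ h1 h2).
  by rewrite ler_wpM2l.
have tot i : (i <= N.+1)%N -> `|E (t i)| <= (D 0 - D (t i)) * (C / N.+1%:R).
  elim: i => [|i IH] iN; first by rewrite t0 E0 normr0 subrr mul0r.
  have h1 := IH (ltnW iN); have h2 := step i iN.
  have := ler_normD (E (t i.+1) - E (t i)) (E (t i)); rewrite subrK => h3.
  rewrite (le_trans h3)// (_ : D 0 - _ = D (t i) - D (t i.+1) + (D 0 - D (t i))).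
    by rewrite mulrDl lerD.
  by ring.
by have := tot N.+1 (leqnn _); rewrite tN mulrA.
Qed.

Section density.
Variable k : nat.
Local Notation D := (@overlap R k).

Lemma psi_ratio_F (l : R) : 0 <= l <= 2 -> psi_ratio k.+1 l = F_ k.+1 l.
Proof.
apply: (@sandwiched_unique D _ _ k.+1).
- by move=> s t; exact: overlap_le.
- by move=> s t st _; exact: psi_ratio_sandwich.
- by move=> s t; exact: F_sandwich.
- by rewrite psi_ratio0 F_0.
Qed.

Definition overlap_dens (x : R) : R := k.+1%:R * x ^+ k * D x.

Lemma P_overlap_dens (x : R) : 0 <= x <= 2 -> P_ k.+1 x = overlap_dens x.
Proof. by move=> x02; rewrite /P_ /= reg_beta_overlap. Qed.

Lemma measurable_overlap_dens : measurable_fun setT overlap_dens.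
Proof.
apply: measurable_funM; first exact: measurable_funM.
by apply: nonincreasing_measurable => // x y xy; exact: overlap_le.
Qed.

Lemma overlap_dens_ge0 x : 0 <= x -> 0 <= overlap_dens x.
Proof. by move=> x0; apply: mulr_ge0 (overlap_ge0 _ _); rewrite mulr_ge0// exprn_ge0. Qed.

Lemma Rintegral_monomial (s t : R) : s <= t ->
  \int[mu]_(x in `[s, t]) (k.+1%:R * x ^+ k) = t ^+ k.+1 - s ^+ k.+1.
Proof.
rewrite le_eqVlt => /predU1P[->|st].
  by rewrite set_itv1 Rintegral_set1 subrr.
rewrite /Rintegral (@continuous_FTC2 _ _ (horner ('X^(k.+1) : {poly R})))//.
- by rewrite !hornerXn.
- apply: continuous_subspaceT => x; apply: cvgM; first exact: cvg_cst.
  exact: exprn_continuous.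
- exact: derivable_oo_LRcontinuous_horner.
- by move=> x _; rewrite -derivE derivXn hornerMn hornerXn mulr_natl.
Qed.

(** Domination by the monomial, as the overlap is at most 1. *)
Lemma integrable_overlap_dens (a b : R) : 0 <= a ->
  mu.-integrable `[a, b] (EFin \o overlap_dens).
Proof.
move=> a0; apply: (@le_integrable _ _ _ mu _ _ _ (EFin \o (fun x => k.+1%:R * x ^+ k))) => //.
- apply/measurable_EFinP; apply: measurable_funTS; exact: measurable_overlap_dens.
- move=> x /=; rewrite in_itv/= => /andP[ax xb]; rewrite lee_fin.
  have x0 : 0 <= x by exact: le_trans ax.
  rewrite ger0_norm ?overlap_dens_ge0// ger0_norm ?mulr_ge0 ?exprn_ge0//.
  by rewrite /overlap_dens ler_piMr ?mulr_ge0 ?exprn_ge0// -(overlap0 k) overlap_le.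
- apply: integrable_cts => x; apply: cvgM; first exact: cvg_cst.
  exact: exprn_continuous.
Qed.

Lemma dens_sandwiched :
  sandwiched D (fun l => \int[mu]_(x in `[0, l]) overlap_dens x) k.+1.
Proof.
move=> s t /andP[s0 st] t2.
have cm r : continuous (fun x : R => r * (k.+1%:R * x ^+ k)).
  move=> x; apply: cvgM; first exact: cvg_cst.
  by apply: cvgM; [exact: cvg_cst|exact: exprn_continuous].
have c1 : continuous (fun x : R => k.+1%:R * x ^+ k).
  by move=> x; apply: cvgM; [exact: cvg_cst|exact: exprn_continuous].
have -> : \int[mu]_(x in `[0, t]) overlap_dens x - \int[mu]_(x in `[0, s]) overlap_dens x
    = \int[mu]_(x in `[s, t]) overlap_dens x.
  rewrite (@Rintegral_itvB _ _ (BLeft 0) (BRight t))//; last exact: integrable_overlap_dens.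
  rewrite Rintegral_itv_obnd_cbnd//.
  apply: integrableS (integrable_overlap_dens t s0) => //.
  by apply: subset_itvr; rewrite bnd_simp.
have iD := integrable_overlap_dens t s0.
rewrite -Rintegral_monomial// -!RintegralZl_cts//.
have i1 r := integrable_cts s t (cm r).
have w0 x : s <= x -> 0 <= k.+1%:R * x ^+ k.
  by move=> sx; rewrite mulr_ge0// exprn_ge0// (le_trans s0).
apply/andP; split; apply: le_Rintegral => // x; rewrite /= in_itv/= => /andP[sx xt].
  by rewrite /overlap_dens [leRHS]mulrC ler_wpM2r ?overlap_le// w0.
by rewrite /overlap_dens [leLHS]mulrC ler_wpM2r ?overlap_le// w0.
Qed.

Lemma F_integral (l : R) : 0 <= l <= 2 ->
  \int[mu]_(x in `[0, l]) overlap_dens x = F_ k.+1 l.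
Proof.
apply: (@sandwiched_unique D (fun l => \int[mu]_(x in `[0, l]) overlap_dens x)
  (F_ k.+1) k.+1).
- by move=> s t; exact: overlap_le.
- exact: dens_sandwiched.
- by move=> s t; exact: F_sandwich.
- by rewrite set_itv1 Rintegral_set1 F_0.
Qed.

Lemma F_2 : F_ k.+1 2 = 1 :> R.
Proof. by rewrite -psi_ratio_F ?psi_ratio_ge2// ler0n lexx. Qed.

Lemma F_integralE (l : R) : 0 <= l <= 2 ->
  (\int[mu]_(x in `[0%R, l]) (overlap_dens x)%:E = (F_ k.+1 l)%:E)%E.
Proof.
move=> l02; rewrite -F_integral// /Rintegral fineK//.
by apply: integral_fune_fin_num => //; exact: integrable_overlap_dens.
Qed.

(** The law with density P_n: the distribution of the distance of two independent
    uniform points of the ball. *)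
Definition overlap_prob (A : set (measurableTypeR R)) : \bar R :=
  (\int[mu]_(x in A `&` `[0%R, 2%R]) (overlap_dens x)%:E)%E.

Let overlap_prob0 : overlap_prob set0 = 0%E.
Proof. by rewrite /overlap_prob set0I integral_set0. Qed.

Let dens_ge0 A x : (A `&` `[0, 2]%classic) x -> (0 <= (overlap_dens x)%:E)%E.
Proof. by move=> [_ /=]; rewrite in_itv/= lee_fin => /andP[x0 _]; exact: overlap_dens_ge0. Qed.

Let overlap_prob_ge0 A : (0 <= overlap_prob A)%E.
Proof. by apply: integral_ge0 => x; exact: dens_ge0. Qed.

Let overlap_prob_sigma_additive : semi_sigma_additive overlap_prob.
Proof.
move=> /= F mF tF mUF; rewrite /overlap_prob setI_bigcupl; apply: cvg_toP.
  apply: ereal_nondecreasing_is_cvgn => m n mn.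
  by apply: lee_sum_nneg_natr => // i _ _; exact: overlap_prob_ge0.
rewrite ge0_integral_bigcup//=.
- by move=> i; exact: measurableI.
- apply: measurable_funTS; apply/measurable_EFinP; exact: measurable_overlap_dens.
- by move=> x [i _]; exact: dens_ge0.
- apply/trivIsetP => i j _ _ ij; rewrite setIACA setIid.
  by move/trivIsetP : tF => -> //; rewrite set0I.
Qed.

HB.instance Definition _ := isMeasure.Build _ _ _ overlap_prob
  overlap_prob0 overlap_prob_ge0 overlap_prob_sigma_additive.

Let overlap_probT : overlap_prob [set: _] = 1%E.
Proof. by rewrite /overlap_prob setTI F_integralE ?F_2// ler0n lexx. Qed.

HB.instance Definition _ := Measure_isProbability.Build _ _ R overlap_prob overlap_probT.

Lemma cdf_F : cdf_with_density (F_ k.+1 : R -> R) (P_ k.+1).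
Proof.
have PE : {in `[0, 2]%classic, P_ k.+1 =1 overlap_dens}.
  by move=> x; rewrite inE/= in_itv/=; exact: P_overlap_dens.
split.
- apply: (eq_measurable_fun overlap_dens); first by move=> x xD; rewrite PE.
  by apply: measurable_funTS; exact: measurable_overlap_dens.
- by move=> x /[dup] /andP[x0 _] x02; rewrite P_overlap_dens// overlap_dens_ge0.
exists overlap_prob; split.
  move=> A mA; apply: eq_integral => x; rewrite inE => -[_ x02].
  by rewrite PE// inE.
move=> x /andP[x0 x2]; rewrite -F_integralE ?x0//= /overlap_prob.
congr (integral _ _ _); apply/seteqP; split => y /=; rewrite !in_itv/=.
  by move=> [-> /andP[->]].
by move=> /andP[-> yx]; rewrite yx (le_trans yx).
Qed.

End density.
End sandwich.

(** * Uniform measures on the ball and on the sphere *)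

Lemma ge0_integral_mrestr d (T : measurableType d) (R : realType)
    (mu : {measure set T -> \bar R}) (B D : set T) (mB : measurable B)
    (f : T -> \bar R) : measurable D -> measurable_fun setT f ->
  (forall x, (0 <= f x)%E) ->
  (\int[mrestr mu mB]_(x in D) f x = \int[mu]_(x in D `&` B) f x)%E.
Proof.
move=> mD mf f0.
have mDB : measurable (D `&` B) by exact: measurableI.
have mDNB : measurable (D `\` B) by exact: measurableD.
transitivity (\int[mrestr mu mB]_(x in D `&` B) f x
    + \int[mrestr mu mB]_(x in D `\` B) f x)%E.
  rewrite -ge0_integral_setU//.
  - by rewrite setUIDK.
  - exact: measurable_funTS.
  - by apply/disj_setPS => x [[_ ?] [_ ?]].
rewrite [X in (_ + X)%E]null_set_integral ?adde0//; last 2 first.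
- exact: measurable_funTS.
- change (mu ((D `\` B) `&` B) = 0%E).
  by rewrite (_ : _ `&` _ = set0) ?measure0//; apply/seteqP; split => // x [[]].
apply: eq_measure_integral => A mA AD; rewrite /mrestr/=; congr (mu _).
by apply/setIidPl => x /AD [].
Qed.

Section cone_functions.
Context {R : realType}.
Variable n : nat.
Local Notation m := (@lebesgue_rV R n).
Local Notation V := 'rV[R]_n.
Implicit Types (f phi : V -> R).

(** The mean over the unit ball, for the uniform probability. *)
Definition ball_avg f : R := (\int[m]_(x in cball 0 1) f x) / ball_vol n.

Lemma norm2_direction (x : V) : x != 0 -> norm2 (direction x) = 1.
Proof.
move=> x0; have h : norm2 x != 0 by apply: contra x0 => /eqP/norm2_eq0 ->.
by rewrite /direction norm2Z ger0_norm ?invr_ge0 ?norm2_ge0// mulVf.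
Qed.

Lemma direction_sphere (x : V) : norm2 x = 1 -> direction x = x.
Proof. by move=> x1; rewrite /direction x1 invr1 scale1r. Qed.

Lemma directionZ (s : R) (x : V) : 0 < s -> direction (s *: x) = direction x.
Proof.
move=> s0; rewrite /direction norm2Z gtr0_norm// invfM scalerA.
by rewrite mulrAC mulVf ?gt_eqF// mul1r.
Qed.

Lemma direction0 : direction (0 : V) = 0.
Proof. by rewrite /direction scaler0. Qed.

Lemma directionK (x : V) : direction (direction x) = direction x.
Proof.
have [->|x0] := eqVneq x 0; first by rewrite !direction0.
by rewrite direction_sphere// norm2_direction.
Qed.

Lemma direction_normE (x : V) : x = norm2 x *: direction x.
Proof.
have [->|x0] := eqVneq x 0; first by rewrite direction0 scaler0.
rewrite /direction scalerA divff ?scale1r//.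
by apply: contra x0 => /eqP/norm2_eq0 ->.
Qed.

Lemma norm2_direction_le1 (x : V) : norm2 (direction x) <= 1.
Proof.
have [->|x0] := eqVneq x 0; first by rewrite direction0 norm20.
by rewrite norm2_direction.
Qed.

(** The dilation by s maps the unit ball onto the ball of radius s, multiplies volumes
    by s ^ n and leaves f unchanged. *)
Lemma cone_integral_scale (s : R) (f : V -> \bar R) : 0 < s ->
  measurable_fun setT f -> (forall x, (0 <= f x)%E) ->
  (forall x, f (s^-1 *: x) = f x) ->
  (\int[m]_(x in cball 0 s) f x = (s ^+ n)%:E * \int[m]_(x in cball 0 1) f x)%E.
Proof.
move=> s0 mf f0 fs.
have mZ : measurable_fun setT ( *:%R s^-1 : V -> V) by exact: measurable_rVZ.
have sn0 : 0 <= s ^+ n by rewrite exprn_ge0// ltW.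
transitivity (\int[pushforward m ( *:%R s^-1 : V -> V)]_(x in cball 0 1) f x)%E.
  rewrite ge0_integral_pushforward//; [|exact: measurable_cball|exact: measurable_funTS].
  under [RHS]eq_integral => x _ do rewrite /= fs.
  congr integral; apply/seteqP; split=> x; rewrite /cball/= !subr0 norm2Z;
    by rewrite ger0_norm ?invr_ge0 ?(ltW s0)// mulrC ler_pdivrMr// mul1r.
rewrite (_ : (s ^+ n)%:E = (NngNum sn0)%:num%:E)// -ge0_integral_mscale//; last 2 first.
- exact: measurable_cball.
- exact: measurable_funTS.
apply: eq_measure_integral => A mA _; rewrite /= /mscale/=.
exact: lebesgue_scale.
Qed.

Lemma measurable_unit_sphere : measurable (@unit_sphere R n).
Proof.
rewrite (_ : unit_sphere = [set x : V | norm2 x <= 1] `&` [set x | 1 <= norm2 x]).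
  by apply: measurableI; apply: measurable_le_set => //; exact: measurable_norm2.
apply/seteqP; split => x /=; first by move=> ->.
by move=> [h1 h2]; apply/eqP; rewrite eq_le h1 h2.
Qed.

Hypothesis n0 : (0 < n)%N.

(** The uniform measure on the sphere is the image of the uniform measure on the ball
    under the direction map, so a function that is constant on rays has the same
    mean for both. The origin, whose direction is not on the sphere, is negligible
    in positive dimension. *)
Lemma cone_integral_sphere (f : V -> \bar R) :
  measurable_fun setT f -> (forall x, (0 <= f x)%E) ->
  (forall x, f (direction x) = f x) ->
  (\int[sphere_measure n]_(x in unit_sphere) f x =
   (ball_vol n)^-1%:E * \int[m]_(x in cball 0 1) f x)%E.
Proof.
move=> mf f0 fd.
have md := @measurable_direction R n.
have mB := @measurable_unit_ball R n.
pose D := @direction R n @^-1` unit_sphere.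
have mD : measurable D.
  by apply: measurable_preimage => //; exact: measurable_unit_sphere.
transitivity (\int[unif_ball n]_(x in D) f x)%E.
  rewrite /sphere_measure ge0_integral_pushforward//.
  - by apply: eq_integral => x _; rewrite /= fd.
  - exact: measurable_unit_sphere.
  - exact: measurable_funTS.
rewrite /unif_ball ge0_integral_mscale//; last exact: measurable_funTS.
congr (_ * _)%E; rewrite ge0_integral_mrestr//.
have -> : D `&` cball 0 1 = cball 0 1 `\` [set 0].
  apply/seteqP; split => x.
    move=> [Dx Bx]; split => // x0; move: Dx; rewrite /D/= x0 direction0 /unit_sphere/=.
    by rewrite norm20 => /eqP; rewrite eq_sym oner_eq0.
  by move=> [Bx /eqP x0]; split => //; rewrite /D/= /unit_sphere/= norm2_direction.
have m0 : m [set 0] = 0%E.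
  rewrite (_ : [set 0] = cball 0 0); last first.
    apply/seteqP; split => x; rewrite /cball/= subr0; first by move=> ->; rewrite norm20.
    by move=> h; apply: norm2_eq0; apply/eqP; rewrite eq_le h norm2_ge0.
  by rewrite lebesgue_cball// expr0n eqn0Ngt n0 mul0r.
have ms0 : measurable [set (0 : V)].
  rewrite (_ : [set 0] = cball 0 0); first exact: measurable_cball.
  apply/seteqP; split => x; rewrite /cball/= subr0; first by move=> ->; rewrite norm20.
  by move=> h; apply: norm2_eq0; apply/eqP; rewrite eq_le h norm2_ge0.
symmetry; rewrite -[in LHS](@setDUK _ [set 0] (cball 0 1)); last first.
  by move=> _ ->; rewrite /cball/= subrr norm20.
rewrite ge0_integral_setU//; last 3 first.
- exact: measurableD.
- exact: measurable_funTS.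
- by apply/disj_setPS => x [x0] [_]; apply.
rewrite [X in (X + _)%E]null_set_integral ?add0e//.
exact: measurable_funTS.
Qed.

Definition unit_valued phi := forall x, 0 <= phi x <= 1.

Lemma unit_valued_integrable phi : measurable_fun setT phi -> unit_valued phi ->
  m.-integrable (cball 0 1) (EFin \o phi).
Proof.
move=> mphi phi01; apply: measurable_bounded_integrable.
- exact: measurable_cball.
- by apply: le_lt_trans (ltry (ball_vol n)); rewrite -ball_volE.
- exact: measurable_funTS.
exists 1; split; first exact: num_real.
move=> M M1 x _ /=; have /andP[h0 h1] := phi01 x.
by rewrite ger0_norm// (le_trans h1)// ltW.
Qed.

(** The right-hand side is the limit of the means over T: the radial condition gives
    the power of s and the angular condition the integral over the sphere. *)
Lemma ball_avg_cone (s t : R) phi : 0 < s <= 1 ->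
  measurable_fun setT phi -> unit_valued phi ->
  ball_avg (fun y => (norm2 y <= s)%R%:R * phi (t *: direction y)) =
  s ^+ n * \int[sphere_measure n]_(x in unit_sphere) phi (t *: direction x).
Proof.
move=> /andP[s0 s1] mphi phi01.
pose f (x : V) := phi (t *: direction x).
have f01 : unit_valued f by move=> x; exact: phi01.
have mf : measurable_fun setT f.
  apply: measurableT_comp mphi _; apply: measurable_rVZ => //.
  exact: measurable_direction.
have mEf : measurable_fun setT (EFin \o f) by exact/measurable_EFinP.
have f0 x : (0 <= (EFin \o f) x)%E by rewrite lee_fin; case/andP: (f01 x).
rewrite /ball_avg.
have -> : \int[m]_(x in cball 0 1) ((norm2 x <= s)%R%:R * phi (t *: direction x)) =
    \int[m]_(x in cball 0 s) f x.
  rewrite (_ : cball 0 s = cball 0 1 `&` cball (0 : V) s); last first.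
    apply/esym/setIidPr => x; rewrite /cball/= subr0 => /le_trans; exact.
  rewrite Rintegral_mkcondr; apply: eq_Rintegral => x _; rewrite patchE.
  case: ifPn; rewrite /cball ?inE ?notin_setE/= subr0; first by move=> ->; rewrite mul1r.
  by move/negP/negbTE ->; rewrite mul0r.
rewrite /Rintegral cone_integral_scale//; last first.
  by move=> x; rewrite /f/= directionZ// invr_gt0.
rewrite [X in _ = _ * fine X](@cone_integral_sphere (EFin \o f))//; last first.
  by move=> x; rewrite /f/= directionK.
have F := integral_fune_fin_num (measurable_cball _ _) (unit_valued_integrable mf f01).
by rewrite !fineM//= -mulrA; congr (_ * _); rewrite mulrC.
Qed.

End cone_functions.

(** * Means over the points of T *)

Lemma ncardE (R : realType) (I : choiceType) (A : set I) : finite_set A ->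
  (ncard A)%:R = \sum_(x \in A) (1 : R).
Proof. by move=> fA; rewrite fsbig_finite// /ncard -sum1_size natr_sum. Qed.

Lemma ncard_le (I : choiceType) (A B : set I) : finite_set B -> A `<=` B ->
  (ncard A <= ncard B)%N.
Proof.
move=> fB AB; apply: fsubset_leq_card; rewrite -fset_set_sub//.
exact: sub_finite_set fB.
Qed.

Section lipschitz.
Context {R : realType} {n : nat}.
Implicit Types (f : 'rV[R]_n -> R) (L : R).

Definition lipschitz2 L f := forall x y, `|f x - f y| <= L * norm2 (x - y).

Lemma norm2_le_sup (x : 'rV[R]_n) : norm2 x <= Num.sqrt n%:R * `|x|.
Proof.
rewrite -(ler_pXn2r (n := 2)) ?nnegrE ?norm2_ge0 ?mulr_ge0 ?sqrtr_ge0//.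
rewrite exprMn sqr_norm2 sqr_sqrtr// mulr_natl.
rewrite -[X in _ *+ X]card_ord -sumr_const; apply: ler_sum => i _.
rewrite expr2 (le_trans (ler_norm _))// normrM.
have h : `|x 0 i| <= `|x| by rewrite [leRHS]mx_normrE; apply: (le_bigmax _ _ (0, i)).
exact: ler_pM.
Qed.

(** The Euclidean norm is at most sqrt n times the sup norm that defines the
    topology. *)
Lemma lipschitz2_continuous L f : 0 <= L -> lipschitz2 L f -> continuous f.
Proof.
move=> L0 Lf x; apply/(@cvgrPdist_lt _ R^o _ (nbhs x)) => e e0.
pose K := L * Num.sqrt n%:R + 1.
have K0 : 0 < K by rewrite ltr_wpDl// mulr_ge0// sqrtr_ge0.
near=> y; apply: le_lt_trans (Lf _ _) _.
apply: (@le_lt_trans _ _ (K * `|x - y|)).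
  apply: (@le_trans _ _ (L * (Num.sqrt n%:R * `|x - y|))).
    by rewrite ler_wpM2l// norm2_le_sup.
  by rewrite mulrA ler_wpM2r// lerDl.
rewrite mulrC -ltr_pdivlMr//.
near: y; apply: cvgr_dist_lt; first exact: cvg_id.
by rewrite divr_gt0.
Unshelve. all: by end_near. Qed.

End lipschitz.

Section mean_values.
Context {R : realType} {n : nat}.
Variable T : set 'rV[R]_n.
Hypothesis n0 : (0 < n)%N.
Hypothesis T_lf : locally_finite T.
Hypothesis T_ne : eventually_nonempty T.
Hypothesis T_ang : angular_condition T.
Hypothesis T_rad : radial_condition T.
Local Notation V := 'rV[R]_n.
Implicit Types (f phi : V -> R) (r s : R).

Definition window r : set V := T `&` cball 0 r.
Definition window_card r : R := (ncard (window r))%:R.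
(** The mean of phi over the points of T in the ball of radius r, rescaled to the unit
    ball. *)
Definition mean_at r phi : R :=
  (\sum_(x <- fset_set (window r)) phi (r^-1 *: x)) / window_card r.

Lemma window_finite r : finite_set (window r).
Proof. exact: T_lf. Qed.

Lemma window_card_ge0 r : 0 <= window_card r. Proof. exact: ler0n. Qed.

Lemma npoints_le_window_card r : (npoints T r)%:R <= window_card r.
Proof.
rewrite ler_nat; apply: ncard_le; first exact: window_finite.
by move=> x [Tx xr]; split=> //; rewrite /cball/= subr0 ltW.
Qed.

Lemma window_card_le_npoints r s : r < s -> window_card r <= (npoints T s)%:R.
Proof.
move=> rs; rewrite ler_nat; apply: ncard_le.
  apply: sub_finite_set (window_finite s) => x [Tx xr].
  by split => //; rewrite /cball/= subr0 ltW.
by move=> x [Tx]; rewrite /cball/= subr0 => xr; split => //; exact: le_lt_trans rs.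
Qed.

Lemma near_npoints_gt0 : \forall r \near +oo, 0 < (npoints T r)%:R :> R.
Proof. by have := T_ne; rewrite /eventually_nonempty; apply: filterS => r; rewrite ltr0n. Qed.

Lemma near_window_card_gt0 : \forall r \near +oo, 0 < window_card r.
Proof.
have := near_npoints_gt0; apply: filterS => r h.
exact: lt_le_trans (npoints_le_window_card r).
Qed.

Lemma cvg_dilation s : 0 < s -> r * s @[r --> +oo] --> +oo.
Proof. by move=> s0; apply: gt0_cvgMly => //; exact: cvg_id. Qed.

(** The radial condition counts points in open balls and the means use closed ones.
    The closed ball of radius r is contained in the open ball of radius q r for every
    q > 1, which has about q ^ n times as many points as the open ball of radius r. *)
Lemma window_card_npoints : window_card r / (npoints T r)%:R @[r --> +oo] --> (1 : R).
Proof.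
apply/cvgrPdist_le => e e0.
have [q [q1 qe]] : exists q : R, 1 < q /\ q ^+ n < 1 + e.
  have : x ^+ n @[x --> (1 : R)^'+] --> (1 : R).
    by rewrite -[X in _ --> X](expr1n R n); apply: cvg_at_right_filter; exact: exprn_continuous.
  move=> /cvgr_lt /(_ (1 + e)); rewrite ltrDl => /(_ e0) H.
  near (1 : R)^'+ => q; exists q; split; first by near: q; exact: nbhs_right_gt.
  by near: q; exact: H.
have q0 : 0 < q by lra.
near=> r.
have M0 : 0 < (npoints T r)%:R :> R by near: r; exact: near_npoints_gt0.
have r0 : 0 < r by near: r; exact: nbhs_pinfty_gt.
have h1 : 1 <= window_card r / (npoints T r)%:R.
  by rewrite ler_pdivlMr// mul1r npoints_le_window_card.
have h2 : window_card r / (npoints T r)%:R <= (npoints T (r * q))%:R / (npoints T r)%:R.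
  by rewrite ler_pM2r ?invr_gt0// window_card_le_npoints// ltr_pMr.
have h3 : (npoints T (r * q))%:R / (npoints T r)%:R <= 1 + e.
  by near: r; apply: cvgr_le qe; exact: T_rad.
rewrite distrC ger0_norm ?subr_ge0//; lra.
Unshelve. all: by end_near. Qed.

Lemma window_card_ratio s : 0 < s -> window_card (r * s) / window_card r @[r --> +oo] --> s ^+ n.
Proof.
move=> s0.
have h1 : window_card (r * s) / (npoints T (r * s))%:R @[r --> +oo] --> (1 : R).
  exact: cvg_comp (cvg_dilation s0) window_card_npoints.
have h2 : (window_card r / (npoints T r)%:R)^-1 @[r --> +oo] --> (1 : R).
  by have := cvgV (oner_neq0 R) window_card_npoints; rewrite invr1; exact.
have h3 : window_card (r * s) / (npoints T (r * s))%:R *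
    ((npoints T (r * s))%:R / (npoints T r)%:R) * (window_card r / (npoints T r)%:R)^-1
    @[r --> +oo] --> s ^+ n.
  rewrite -[X in _ --> X]mul1r -[X in _ --> X]mulr1.
  by apply: (cvgM _ h2); apply: (cvgM h1); exact: T_rad.
apply: (cvg_trans _ h3); apply: near_eq_cvg; near=> r.
have M0 : 0 < (npoints T r)%:R :> R by near: r; exact: near_npoints_gt0.
have Ms0 : 0 < (npoints T (r * s))%:R :> R.
  by near: r; exact: (cvg_dilation s0 near_npoints_gt0).
have N0 : 0 < window_card r by exact: lt_le_trans (npoints_le_window_card r).
rewrite /= invf_div; field; rewrite !gt_eqF//.
Unshelve. all: by end_near. Qed.

Definition equidistributed phi := mean_at r phi @[r --> +oo] --> ball_avg phi.

(** The points that contribute are those of the ball of radius s r. Their proportion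
    tends to s ^ n by the radial condition, and the mean over them of a function of
    the direction converges by the angular condition. *)
Lemma equidistributed_cone s t phi L : 0 < s <= 1 -> 0 <= L ->
  lipschitz2 L phi -> measurable_fun setT phi -> unit_valued phi ->
  equidistributed (fun y => (norm2 y <= s)%R%:R * phi (t *: direction y)).
Proof.
move=> /andP[s0 s1] L0 Lphi mphi phi01.
rewrite /equidistributed ball_avg_cone ?s0//.
pose f x := phi (t *: direction x).
have fd x : f (direction x) = f x by rewrite /f directionK.
have cf : {within unit_sphere, continuous f}.
  have h : {in unit_sphere, (fun x => phi (t *: x)) =1 f}.
    by move=> x; rewrite inE /f => x1; rewrite direction_sphere.
  apply: (subspace_eq_continuous h).
  apply: continuous_subspaceT => x.
  apply: (@continuous_comp _ _ _ (fun x : V => t *: x) phi).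
    exact: scaler_continuous.
  exact: lipschitz2_continuous L0 Lphi _.
have h1 := T_ang cf (fun x _ => esym (fd x)).
have {}h1 := cvg_comp _ _ (cvg_dilation s0) h1.
have h2 : (\sum_(x \in T `&` cball 0 (r * s)) f x) / (ncard (T `&` cball 0 (r * s)))%:R
    * (window_card (r * s) / window_card r) @[r --> +oo]
    --> s ^+ n * (\int[sphere_measure n]_(x in unit_sphere) f x).
  by rewrite [X in _ --> X]mulrC; apply: (cvgM h1); exact: window_card_ratio.
apply: (cvg_trans _ h2); apply: near_eq_cvg; near=> r.
have r0 : 0 < r by near: r; exact: nbhs_pinfty_gt.
have Ns0 : 0 < window_card (r * s) by near: r; exact: (cvg_dilation s0 near_window_card_gt0).
rewrite /= /mean_at mulrA; congr (_ / _).
rewrite -/(window (r * s)) -/(window_card (r * s)) divfK ?gt_eqF//.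
have -> : window (r * s) = window r `&` cball 0 (r * s).
  rewrite /window -setIA; congr (_ `&` _); apply/esym/setIidPr => x.
  by rewrite /cball/= subr0 => /le_trans; apply; rewrite ler_piMr// ltW.
rewrite fsbig_mkcondr fsbig_finite; last exact: window_finite.
apply: eq_bigr => x _.
have -> : (norm2 (r^-1 *: x) <= s) = (norm2 x <= r * s).
  by rewrite norm2Z gtr0_norm ?invr_gt0// mulrC ler_pdivrMr// mulrC.
rewrite directionZ ?invr_gt0//.
case: ifPn; rewrite /cball ?inE ?notin_setE/= subr0; first by move=> ->; rewrite mul1r.
by move/negP/negbTE ->; rewrite mul0r.
Unshelve. all: by end_near. Qed.

End mean_values.

(** * Equidistribution of Lipschitz functions *)

Section ball_avg_linear.
Context {R : realType} {n : nat}.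
Local Notation m := (@lebesgue_rV R n).
Local Notation V := 'rV[R]_n.
Implicit Types (f g : V -> R) (c : R).

Definition ball_integrable f := m.-integrable (cball 0 1) (EFin \o f).

Let mB : measurable (cball 0 1 : set V). Proof. exact: measurable_cball. Qed.

Lemma ball_integrableD f g : ball_integrable f -> ball_integrable g ->
  ball_integrable (fun x => f x + g x).
Proof. by move=> hf hg; have := integrableD mB hf hg; apply. Qed.

Lemma ball_integrableZ c f : ball_integrable f -> ball_integrable (fun x => c * f x).
Proof. by move=> hf; have := integrableZl mB c hf; apply. Qed.

Lemma ball_avgD f g : ball_integrable f -> ball_integrable g ->
  ball_avg (fun x => f x + g x) = ball_avg f + ball_avg g.
Proof. by move=> hf hg; rewrite /ball_avg RintegralD// mulrDl. Qed.

Lemma ball_avgZ c f : ball_integrable f ->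
  ball_avg (fun x => c * f x) = c * ball_avg f.
Proof. by move=> hf; rewrite /ball_avg RintegralZl// mulrA. Qed.

Lemma ball_avg_cst c : ball_avg (fun _ : V => c) = c.
Proof.
rewrite /ball_avg Rintegral_cst// [X in fine X](_ : _ = (ball_vol n)%:E); last exact: ball_volE.
by rewrite mulfK// gt_eqF// ball_vol_gt0.
Qed.

Lemma ball_avg_le f g : ball_integrable f -> ball_integrable g ->
  (forall x, norm2 x <= 1 -> f x <= g x) -> ball_avg f <= ball_avg g.
Proof.
move=> hf hg fg; rewrite ler_pM2r ?invr_gt0 ?ball_vol_gt0//.
by apply: le_Rintegral => // x; rewrite /cball/= subr0; exact: fg.
Qed.

Lemma ball_integrable_cst c : ball_integrable (fun=> c).
Proof.
have := @unit_valued_integrable R n (cst 1) _ _.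
move=> h; rewrite (_ : (fun=> c) = fun x : V => c * 1); last first.
  by apply/funext => x; rewrite mulr1.
apply: ball_integrableZ; apply: h; first exact: measurable_cst.
by move=> x; rewrite ler01 lexx.
Qed.

Lemma ball_avg_dist f g e : ball_integrable f -> ball_integrable g ->
  (forall x, norm2 x <= 1 -> `|f x - g x| <= e) ->
  `|ball_avg f - ball_avg g| <= e.
Proof.
move=> hf hg fg.
have ie := ball_integrable_cst e.
have h1 : ball_avg f <= ball_avg g + e.
  rewrite -[X in _ + X]ball_avg_cst -ball_avgD//; apply: ball_avg_le => //.
    exact: ball_integrableD.
  by move=> x /fg; rewrite ler_norml => /andP[_]; rewrite lerBlDl addrC.
have h2 : ball_avg g <= ball_avg f + e.
  rewrite -[X in _ + X]ball_avg_cst -ball_avgD//; apply: ball_avg_le => //.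
    exact: ball_integrableD.
  move=> x /fg; rewrite ler_norml => /andP[+ _]; lra.
by rewrite ler_norml; apply/andP; split; lra.
Qed.

End ball_avg_linear.

Section equidistribution.
Context {R : realType} {n : nat}.
Variable T : set 'rV[R]_n.
Hypothesis n0 : (0 < n)%N.
Hypothesis T_lf : locally_finite T.
Hypothesis T_ne : eventually_nonempty T.
Hypothesis T_ang : angular_condition T.
Hypothesis T_rad : radial_condition T.
Local Notation V := 'rV[R]_n.
Implicit Types (f g phi : V -> R) (r s : R).
Local Notation mean_at := (mean_at T).
Local Notation window_card := (window_card T).

Lemma mean_atD r f g : mean_at r (fun x => f x + g x) = mean_at r f + mean_at r g.
Proof. by rewrite /mean_at big_split/= mulrDl. Qed.

Lemma mean_atZ r c f : mean_at r (fun x => c * f x) = c * mean_at r f.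
Proof. by rewrite /mean_at -mulr_sumr mulrA. Qed.

Lemma mean_at_cst r c : 0 < window_card r -> mean_at r (fun=> c) = c.
Proof.
move=> N0; rewrite /mean_at big_const_seq count_predT iter_addr_0.
by rewrite -[_ *+ _]mulr_natr mulfK// gt_eqF.
Qed.

Lemma window_scaled r x : 0 < r -> x \in fset_set (window T r) -> norm2 (r^-1 *: x) <= 1.
Proof.
move=> r0; rewrite in_fset_set; last exact: window_finite.
rewrite inE => -[_]; rewrite /cball/= subr0 norm2Z gtr0_norm ?invr_gt0//.
by rewrite mulrC ler_pdivrMr// mul1r.
Qed.

Lemma mean_at_le r f g : 0 < r ->
  (forall x, norm2 x <= 1 -> f x <= g x) -> mean_at r f <= mean_at r g.
Proof.
move=> r0 fg; rewrite ler_wpM2r ?invr_ge0 ?window_card_ge0//.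
rewrite big_seq_cond [leRHS]big_seq_cond; apply: ler_sum => x.
by rewrite andbT => xW; apply/fg/window_scaled.
Qed.

Lemma mean_at_dist r f g e : 0 < r -> 0 < window_card r ->
  (forall x, norm2 x <= 1 -> `|f x - g x| <= e) ->
  `|mean_at r f - mean_at r g| <= e.
Proof.
move=> r0 N0 fg.
have h1 : mean_at r f <= mean_at r g + e.
  rewrite -[X in _ + X](@mean_at_cst r)// -mean_atD; apply: mean_at_le => //.
  by move=> x /fg; rewrite ler_norml => /andP[_]; rewrite lerBlDl addrC.
have h2 : mean_at r g <= mean_at r f + e.
  rewrite -[X in _ + X](@mean_at_cst r)// -mean_atD; apply: mean_at_le => //.
  move=> x /fg; rewrite ler_norml => /andP[+ _]; lra.
by rewrite ler_norml; apply/andP; split; lra.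
Qed.

(** Integrability makes the mean over the ball additive, hence the class linear. *)
Definition admissible f := ball_integrable f /\ equidistributed T f.

Lemma admissibleD f g : admissible f -> admissible g ->
  admissible (fun x => f x + g x).
Proof.
move=> [if_ ef] [ig eg]; split; first exact: ball_integrableD.
rewrite /equidistributed ball_avgD//.
under eq_fun do rewrite mean_atD.
exact: cvgD.
Qed.

Lemma admissibleZ c f : admissible f -> admissible (fun x => c * f x).
Proof.
move=> [if_ ef]; split; first exact: ball_integrableZ.
rewrite /equidistributed ball_avgZ//.
under eq_fun do rewrite mean_atZ.
by apply: cvgM => //; exact: cvg_cst.
Qed.

Lemma admissible_cst c : admissible (fun=> c).
Proof.
split; first exact: ball_integrable_cst.
rewrite /equidistributed ball_avg_cst; apply: cvg_near_cst.
by have := near_window_card_gt0 T_lf T_ne; apply: filterS => r; exact: mean_at_cst.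
Qed.

Lemma admissible_sum k (F : nat -> V -> R) : (forall i, (i < k)%N -> admissible (F i)) ->
  admissible (fun x => \sum_(i < k) F i x).
Proof.
elim: k => [|k IH] hF.
  under eq_fun do rewrite big_ord0.
  exact: admissible_cst.
under eq_fun do rewrite big_ord_recr/=.
by apply: admissibleD; [apply: IH => i ik; exact/hF/ltnW|exact: hF].
Qed.

(** Both the means over T and the mean over the ball move by at most e when the
    function moves by at most e on the unit ball. *)
Lemma admissible_uniform f : ball_integrable f ->
  (forall e : R, 0 < e -> exists2 g, admissible g &
     forall x, norm2 x <= 1 -> `|f x - g x| <= e) -> admissible f.
Proof.
move=> if_ H; split=> //; apply/cvgrPdist_le => e e0.
have e30 : 0 < e / 3 by rewrite divr_gt0.
have [g [ig eg] fg] := H _ e30.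
have {eg} /cvgrPdist_le /(_ _ e30) eg := eg.
have d1 := ball_avg_dist if_ ig fg.
near=> r.
have r0 : 0 < r by near: r; exact: nbhs_pinfty_gt.
have N0 : 0 < window_card r by near: r; exact: near_window_card_gt0.
have d2 := mean_at_dist r0 N0 fg.
have d3 : `|ball_avg g - mean_at r g| <= e / 3 by near: r; exact: eg.
move: d1 d2 d3; rewrite !ler_norml => /andP[? ?] /andP[? ?] /andP[? ?].
by apply/andP; split; lra.
Unshelve. all: by end_near. Qed.

(** The ball is cut into k shells, and on each of them phi y is replaced by the value of
    phi at the point of the outer sphere with the same direction. This changes phi by
    at most L / k, and the result is a combination of functions of the direction
    restricted to balls, whose means converge. *)
Lemma admissible_lipschitz L phi : 0 <= L -> lipschitz2 L phi ->
  measurable_fun setT phi -> unit_valued phi -> admissible phi.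
Proof.
move=> L0 Lphi mphi phi01.
apply: admissible_uniform; first exact: unit_valued_integrable.
move=> e e0.
pose k := (Num.bound (L / e)).+1.
pose t (j : nat) : R := j%:R / k%:R.
have k0 : 0 < k%:R :> R by rewrite ltr0n.
have Lk : L / k%:R <= e.
  have : 0 <= L / e by rewrite divr_ge0// ltW.
  move=> /archi_boundP h; rewrite ler_pdivrMr// mulrC -ler_pdivrMr//.
  by rewrite (le_trans (ltW h))// ler_nat.
pose cone s u (y : V) := (norm2 y <= s)%R%:R * phi (u *: direction y).
have cone_adm i j : (0 < i <= k)%N -> admissible (cone (t i) (t j)).
  move=> /andP[i0 ik].
  have ti : 0 < t i <= 1.
    by rewrite divr_gt0 ?ltr0n//= ler_pdivrMr// mul1r ler_nat.
  split; last exact: equidistributed_cone Lphi mphi phi01.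
  apply: unit_valued_integrable.
    apply: measurable_funM; last first.
      apply: measurableT_comp mphi _; apply: measurable_rVZ => //.
      exact: measurable_direction.
    rewrite (_ : (fun y => _) = \1_[set y : V | norm2 y <= t i]).
      by apply: measurable_indic; apply: measurable_le_set => //; exact: measurable_norm2.
    apply/funext => y; rewrite indicE; congr (_%:R); congr nat_of_bool.
    by apply/idP/idP => [h|/set_mem//]; exact: mem_set.
  move=> y; have /andP[h0 h1] := phi01 (t j *: direction y); rewrite /cone.
  by case: (norm2 y <= t i); rewrite ?mul1r ?mul0r ?h0 ?h1 ?lexx ?ler01.
(* The i-th shell has the indicator a i.+1 - a i; as a 0 vanishes, the innermost shell
   contains the origin. *)
pose a (j : nat) (y : V) : R := ((0 < j)%N && (norm2 y <= t j))%:R.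
have a0 y : a 0%N y = 0 by [].
pose F i y := (a i.+1 y - a i y) * phi (t i.+1 *: direction y).
exists (fun y => \sum_(i < k) F i y).
  apply: admissible_sum => i ik.
  rewrite (_ : F i = fun y => cone (t i.+1) (t i.+1) y +
      (- (0 < i)%N%:R) * cone (t i) (t i.+1) y); last first.
    apply/funext => y; rewrite /F; case: i {ik} => [|i].
      by rewrite a0 subr0 /a /cone /= oppr0 mul0r addr0.
    by rewrite /a /cone /= mulN1r mulrBl.
  apply: admissibleD; first exact: cone_adm.
  case: i ik => [|i] ik; last by apply: admissibleZ; apply: cone_adm; exact: ltnW.
  by under eq_fun do rewrite /= oppr0 mul0r; exact: admissible_cst.
move=> y y1.
have a01 i : 0 <= a i.+1 y - a i y.
  rewrite subr_ge0 /a ler_nat/=; case: (0 < i)%N => //=.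
  case: (leP (norm2 y) (t i)) => // h; rewrite (le_trans h)//.
  by rewrite ler_pM2r ?invr_gt0// ler_nat.
(* The shells partition the ball, so phi y is the sum of its copies on the shells. *)
have tot : \sum_(i < k) (a i.+1 y - a i y) = 1.
  rewrite -(big_mkord predT (fun i => a i.+1 y - a i y)) telescope_sumr//.
  by rewrite a0 /a /= /t divff ?gt_eqF// y1 subr0.
rewrite -[phi y]mul1r -tot mulr_suml -sumrB; apply: le_trans (ler_norm_sum _ _ _) _.
apply: (@le_trans _ _ (\sum_(i < k) (a i.+1 y - a i y) * e)); last first.
  by rewrite -mulr_suml tot mul1r.
apply: ler_sum => i _; rewrite /F -mulrBr normrM ger0_norm//.
have [->|ai] := eqVneq (a i.+1 y - a i y) 0; first by rewrite !mul0r.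
rewrite ler_wpM2l//; apply: le_trans (Lphi _ _) _; apply: le_trans Lk.
rewrite ler_wpM2l//.
have [h1 h2] : norm2 y <= t i.+1 /\ t i <= norm2 y.
  move: (ai); rewrite /a /=; case: leP => [h _|h]; last first.
    rewrite (_ : _ && _ = false) ?subrr ?eqxx//; apply/negP => /andP[_ h'].
    by move: h; rewrite ltNge (le_trans h')// ler_pM2r ?invr_gt0// ler_nat.
  split => //; case: (posnP i) => [->|i0]; first by rewrite /t mul0r norm2_ge0.
  move: ai; rewrite /a /= h i0/=; case: leP => [_|/ltW//].
  by rewrite subrr eqxx.
rewrite {1}(direction_normE y) -scalerBl norm2Z.
apply: (@le_trans _ _ (`|norm2 y - t i.+1| * 1)).
  by rewrite ler_wpM2l// norm2_direction_le1.
have tS : t i.+1 = t i + k%:R^-1 by rewrite /t -natr1 mulrDl mul1r.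
by rewrite mulr1 ler_norml; apply/andP; split; lra.
Qed.

End equidistribution.

(** * Pairs of points *)

Section kernels.
Context {R : realType} {n : nat}.
Local Notation m := (@lebesgue_rV R n).
Local Notation V := 'rV[R]_n.

(** Measurability for the product sigma-algebra comes from Tonelli, which spares a
    comparison with the topology. *)
Lemma measurable_ball_avg (k : V -> V -> R) :
  measurable_fun setT (fun p : V * V => k p.1 p.2) ->
  (forall a, unit_valued (k a)) ->
  measurable_fun setT (fun a => ball_avg (k a)).
Proof.
move=> mk k01; apply: measurable_funM => //.
pose h (p : V * V) := ((k p.1 p.2)%:E * (\1_(cball 0 1) p.2 : R)%:E)%E.
have mh : measurable_fun setT h.
  apply: emeasurable_funM; first exact/measurable_EFinP.
  exact: measurableT_comp (measurable_EFin_indic (measurable_cball _ _)) measurable_snd.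
have h0 p : (0 <= h p)%E by rewrite mule_ge0 ?EFin_indic_ge0// lee_fin; case/andP: (k01 p.1 p.2).
have := measurable_fun_fubini_tonelli_F (m2 := m) h mh h0.
move=> /(measurableT_comp (fine_measurable measurableT)).
congr measurable_fun; apply/funext => a; rewrite /= /fubini_F /h/= /Rintegral.
rewrite [in RHS]integral_mkcond; congr fine; apply: eq_integral => y _.
rewrite patchE indicE; case: ifPn => _; by rewrite ?mule1 ?mule0.
Qed.

Lemma unit_valued_ball_avg (k : V -> V -> R) :
  measurable_fun setT (fun p : V * V => k p.1 p.2) ->
  (forall a, unit_valued (k a)) ->
  unit_valued (fun a => ball_avg (k a)).
Proof.
move=> mk k01 a.
have ik : ball_integrable (k a).
  apply: unit_valued_integrable => //.
  exact: (measurableT_comp mk (measurable_pair1 a)).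
rewrite -[X in X <= _ <= _](@ball_avg_cst R n) -[X in _ <= _ <= X](@ball_avg_cst R n).
apply/andP; split.
  by apply: (ball_avg_le (ball_integrable_cst _) ik) => y _; case/andP: (k01 a y).
by apply: (ball_avg_le ik (ball_integrable_cst _)) => y _; case/andP: (k01 a y).
Qed.

Definition close_kernel (l : R) (a b : V) : R := (norm2 (a - b) <= l)%R%:R.

Lemma close_kernel01 l a : unit_valued (close_kernel l a).
Proof. by move=> b; rewrite /close_kernel; case: (_ <= l); rewrite ?lexx ?ler01. Qed.

Lemma measurable_close_kernel l :
  measurable_fun setT (fun p : V * V => close_kernel l p.1 p.2).
Proof.
rewrite (_ : (fun p => _) = \1_[set p : V * V | norm2 (p.1 - p.2) <= l]).
  apply: measurable_indic; apply: measurable_le_set => //.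
  by apply: measurable_norm2_comp; exact: measurable_rVB.
apply/funext => p; rewrite indicE; congr (_%:R); congr nat_of_bool.
by apply/idP/idP => [h|/set_mem//]; exact: mem_set.
Qed.

Lemma psi_ratioE (l : R) :
  psi_ratio n l = ball_avg (fun a => ball_avg (close_kernel l a)).
Proof.
have v0 := @ball_vol_gt0 R n; have vN0 : ball_vol n != 0 :> R by rewrite gt_eqF.
have mk := measurable_close_kernel l; have k01 := close_kernel01 l.
pose P a := ball_avg (close_kernel l a).
have mP : measurable_fun setT P by exact: measurable_ball_avg.
have P01 : unit_valued P by exact: unit_valued_ball_avg.
have iP : ball_integrable P by exact: unit_valued_integrable.
have fin (f : V -> R) : ball_integrable f ->
    (\int[m]_(x in cball 0 1) (f x)%:E)%E = (ball_vol n * ball_avg f)%:E.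
  move=> if_; rewrite /ball_avg mulrC divfK// /Rintegral fineK//.
  by apply: integral_fune_fin_num => //; exact: measurable_cball.
rewrite /psi_ratio integral_row_mx_set; last exact: measurable_Psi.
rewrite (_ : (\int[_]_x _)%E = (ball_vol n * (ball_vol n * ball_avg P))%:E).
  by rewrite /= mulrA -expr2 mulrC mulKf// expf_neq0.
rewrite -ball_avgZ// -fin; last exact: ball_integrableZ.
rewrite [RHS]integral_mkcond; apply: eq_integral => a _.
have ik : ball_integrable (close_kernel l a).
  apply: unit_valued_integrable => //.
  exact: (measurableT_comp mk (measurable_pair1 a)).
rewrite patchE; case: ifPn; rewrite ?inE ?notin_setE => a1.
  rewrite -fin// [RHS]integral_mkcond; apply: eq_integral => b _.
  rewrite patchE indicE.
  have E : Psi n l (row_mx a b) <-> norm2 b <= 1 /\ norm2 (a - b) <= l.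
    rewrite /Psi/= row_mxKl row_mxKr; move: a1; rewrite /cball/= subr0.
    by split => [[]|[]].
  case: ifPn; rewrite ?inE ?notin_setE /cball/= subr0 => b1.
    rewrite /close_kernel; congr (_%:R%:E); congr nat_of_bool.
    by apply/idP/idP => [/set_mem/E[]//|h]; apply/mem_set/E.
  by rewrite memNset// => /E[].
rewrite integral0_eq// => b _; rewrite indicE memNset//.
by move=> [+ _ _]; rewrite row_mxKl => h; apply: a1; rewrite /cball/= subr0.
Qed.

Lemma lipschitz2_norm2 (a : V) : lipschitz2 1 (fun y => norm2 (a - y)).
Proof.
move=> x y; rewrite mul1r (le_trans (ler_dist_norm2 _ _))//.
by rewrite opprB addrC addrA subrK norm2_distC.
Qed.

Lemma compact_ball : compact (cball 0 1 : set V).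
Proof.
apply: bounded_closed_compact.
  exists 1; split; first exact: num_real.
  move=> M M1 x; rewrite /cball/= subr0 => x1.
  rewrite [leLHS]mx_normrE; apply: bigmax_le; first by rewrite ltW// (lt_trans ltr01).
  move=> i _; rewrite (ord1 i.1).
  exact: le_trans (coord_le_norm2 _ _) (le_trans x1 (ltW M1)).
apply: (@closed_comp _ _ (fun y : V => norm2 (y - 0)) [set t | t <= 1]).
  move=> x _; apply: (@lipschitz2_continuous R n 1) => // y z.
  by rewrite mul1r !subr0 ler_dist_norm2.
exact: closed_le.
Qed.

(** The overlap is at most 1, so this is the Lipschitz bound of x ^ n on [0, 2]. *)
Lemma psi_ratio_lip k (s t : R) : 0 <= s <= t -> t <= 2 ->
  psi_ratio k.+1 t - psi_ratio k.+1 s <= k.+1%:R * 2 ^+ k.+1 * (t - s).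
Proof.
move=> st t2; have /andP[_ h1] := psi_ratio_sandwich k st.
have /andP[h2 h3] := exprB_le k.+1 st t2.
apply: le_trans h1 _; apply: le_trans h3; rewrite ler_piMl//.
by rewrite -(overlap0 k) overlap_le//; case/andP: st.
Qed.

End kernels.

Section ramp.
Context {R : realType}.
Implicit Types (a d t : R).

(** The continuous function that is 1 up to a, 0 from a + d on, and affine in between. *)
Definition ramp a d t : R := Num.min 1 (Num.max 0 ((a + d - t) / d)).

Lemma ramp01 a d t : 0 <= ramp a d t <= 1.
Proof. by rewrite /ramp le_min ge_min le_max !lexx ler01. Qed.

Lemma ramp_ge a d t : 0 < d -> t <= a -> ramp a d t = 1.
Proof.
move=> d0 ta; rewrite /ramp min_l// le_max; apply/orP; right.
by rewrite ler_pdivlMr// mul1r; lra.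
Qed.

Lemma ramp_le a d t : 0 < d -> a + d <= t -> ramp a d t = 0.
Proof.
move=> d0 ta; rewrite /ramp max_l ?min_r//.
by rewrite ler_pdivrMr// mul0r; lra.
Qed.

Lemma clamp_lip (x y : R) :
  `|Num.min 1 (Num.max 0 x) - Num.min 1 (Num.max 0 y)| <= `|x - y|.
Proof.
have h := ler_norm (x - y); have h' := ler_norm (y - x); rewrite distrC in h'.
have c (z : R) : [\/ z <= 0 /\ Num.min 1 (Num.max 0 z) = 0,
    [/\ 0 <= z, z <= 1 & Num.min 1 (Num.max 0 z) = z] |
    1 <= z /\ Num.min 1 (Num.max 0 z) = 1].
  have [z0|z0] := leP z 0; first by apply: Or31; rewrite min_r.
  have [z1|z1] := leP z 1; first by apply: Or32; split=> //; exact: ltW.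
  by apply: Or33; split=> //; exact: ltW.
have [[? ->]|[? ? ->]|[? ->]] := c x; have [[? ->]|[? ? ->]|[? ->]] := c y;
  rewrite ler_norml; apply/andP; split; lra.
Qed.

Lemma ramp_lip a d (s t : R) : 0 < d -> `|ramp a d s - ramp a d t| <= d^-1 * `|s - t|.
Proof.
move=> d0; rewrite /ramp (le_trans (clamp_lip _ _))// -mulrBl normrM mulrC.
rewrite ger0_norm ?invr_ge0 ?(ltW d0)// ler_pM2l ?invr_gt0//.
by rewrite opprB addrC addrA subrK distrC.
Qed.

Lemma measurable_ramp a d : measurable_fun setT (ramp a d).
Proof.
apply: measurable_minr => //; apply: measurable_maxr => //.
by apply: measurable_funM => //; exact: measurable_funB.
Qed.

End ramp.

Section pair_averages.
Context {R : realType} {n : nat}.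
Variable T : set 'rV[R]_n.
Hypothesis n0 : (0 < n)%N.
Hypothesis T_lf : locally_finite T.
Hypothesis T_ne : eventually_nonempty T.
Hypothesis T_ang : angular_condition T.
Hypothesis T_rad : radial_condition T.
Local Notation V := 'rV[R]_n.
Local Notation mean_at := (mean_at T).
Local Notation window_card := (window_card T).

Definition pair_mean r (k : V -> V -> R) := mean_at r (fun a => mean_at r (k a)).

Lemma pair_mean_le r k1 k2 : 0 < r -> (forall a b, k1 a b <= k2 a b) ->
  pair_mean r k1 <= pair_mean r k2.
Proof.
move=> r0 h; apply: (mean_at_le T_lf r0) => a _; apply: (mean_at_le T_lf r0) => b _.
exact: h.
Qed.

Section ramp_kernel.
Variables (l d : R).
Hypothesis d0 : 0 < d.

Definition ramp_kernel (a b : V) : R := ramp l d (norm2 (a - b)).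

Let L := d^-1.
Let L0 : 0 <= L. Proof. by rewrite invr_ge0 ltW. Qed.

Lemma ramp_kernel01 a : unit_valued (ramp_kernel a).
Proof. by move=> b; exact: ramp01. Qed.

Lemma measurable_ramp_kernel :
  measurable_fun setT (fun p : V * V => ramp_kernel p.1 p.2).
Proof.
apply: measurableT_comp (measurable_ramp l d) _.
by apply: measurable_norm2_comp; exact: measurable_rVB.
Qed.

Lemma ramp_kernelC a b : ramp_kernel a b = ramp_kernel b a.
Proof. by rewrite /ramp_kernel norm2_distC. Qed.

Lemma ramp_kernel_lipr a : lipschitz2 L (ramp_kernel a).
Proof.
move=> x y; apply: le_trans (ramp_lip _ _ _ d0) _; rewrite ler_wpM2l//.
by have := lipschitz2_norm2 a x y; rewrite mul1r.
Qed.

Lemma ramp_kernel_lipl a a' b : `|ramp_kernel a b - ramp_kernel a' b| <= L * norm2 (a - a').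
Proof. by rewrite !(ramp_kernelC _ b); exact: ramp_kernel_lipr. Qed.

Lemma ramp_kernel_integrable a : ball_integrable (ramp_kernel a).
Proof.
apply: unit_valued_integrable; last exact: ramp_kernel01.
exact: (measurableT_comp measurable_ramp_kernel (measurable_pair1 a)).
Qed.

Let Phi a := ball_avg (ramp_kernel a).

Lemma ramp_avg_lip : lipschitz2 L Phi.
Proof.
move=> a a'; apply: ball_avg_dist; [exact: ramp_kernel_integrable..|].
by move=> b _; exact: ramp_kernel_lipl.
Qed.

(** The average of the kernel over its second variable inherits the Lipschitz bound in
    the first one. *)
Lemma ramp_avg_admissible : admissible T Phi.
Proof.
apply: (admissible_lipschitz n0 T_lf T_ne T_ang T_rad L0 ramp_avg_lip).
  by apply: measurable_ball_avg; [exact: measurable_ramp_kernel|exact: ramp_kernel01].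
by apply: unit_valued_ball_avg; [exact: measurable_ramp_kernel|exact: ramp_kernel01].
Qed.

Lemma ramp_kernel_admissible a : admissible T (ramp_kernel a).
Proof.
apply: (admissible_lipschitz n0 T_lf T_ne T_ang T_rad L0 (@ramp_kernel_lipr a)).
  exact: (measurableT_comp measurable_ramp_kernel (measurable_pair1 a)).
exact: ramp_kernel01.
Qed.

(** For a fixed point a the means of the kernel converge. They and their limit are
    equi-Lipschitz in a, and the ball is compact, so the convergence is uniform in a. *)
Lemma ramp_uniform (e : R) : 0 < e ->
  \forall r \near +oo, forall a, norm2 a <= 1 ->
    `|mean_at r (ramp_kernel a) - Phi a| <= e.
Proof.
move=> e0.
have /compact_near_coveringP H := @compact_ball R n.
have {H} := H R (+oo) (fun r a => `|mean_at r (ramp_kernel a) - Phi a| <= e) _ _.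
move=> H.
suff : \forall r \near +oo, (cball 0 1 : set V) `<=`
    (fun a => `|mean_at r (ramp_kernel a) - Phi a| <= e).
  by apply: filterS => r h a a1; apply: h; rewrite /cball/= subr0.
apply: H => x _.
have e30 : 0 < e / 3 by rewrite divr_gt0.
have [_ /cvgrPdist_le /(_ _ e30) Hx] := ramp_kernel_admissible x.
have cn : continuous (fun y : V => norm2 (x - y)).
  by apply: (@lipschitz2_continuous R n 1) => //; exact: lipschitz2_norm2.
have de : 0 < d * (e / 3) by rewrite mulr_gt0.
near=> y r => /=.
have r0 : 0 < r by near: r; exact: nbhs_pinfty_gt.
have N0 : 0 < window_card r by near: r; exact: near_window_card_gt0.
have h1 : `|Phi x - mean_at r (ramp_kernel x)| <= e / 3 by near: r; exact: Hx.
have h2 : norm2 (x - y) <= d * (e / 3).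
  near: y; have : norm2 (x - y) @[y --> x] --> norm2 (x - x) by exact: cn.
  by rewrite subrr norm20 => /cvgr_le; apply.
have h3 : L * norm2 (x - y) <= e / 3 by rewrite /L mulrC ler_pdivrMr// mulrC.
have h4 : `|Phi x - Phi y| <= e / 3 by exact: le_trans (ramp_avg_lip x y) h3.
have h5 : `|mean_at r (ramp_kernel x) - mean_at r (ramp_kernel y)| <= e / 3.
  apply: (mean_at_dist T_lf r0 N0) => b _; exact: le_trans (ramp_kernel_lipl x y b) h3.
move: h1 h4 h5; rewrite !ler_norml => /andP[? ?] /andP[? ?] /andP[? ?].
by apply/andP; split; lra.
Unshelve. all: by end_near. Qed.

(** The inner mean is replaced by its limit, uniformly in the first point; the limit
    is itself a Lipschitz function of that point, so the outer mean converges. *)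
Lemma ramp_pair_mean : pair_mean r ramp_kernel @[r --> +oo] --> ball_avg Phi.
Proof.
apply/cvgrPdist_le => e e0.
have e20 : 0 < e / 2 by rewrite divr_gt0.
have [_ /cvgrPdist_le /(_ _ e20) H] := ramp_avg_admissible.
have U := ramp_uniform e20.
near=> r.
have r0 : 0 < r by near: r; exact: nbhs_pinfty_gt.
have N0 : 0 < window_card r by near: r; exact: near_window_card_gt0.
have h1 : `|ball_avg Phi - mean_at r Phi| <= e / 2 by near: r; exact: H.
have h2 : `|pair_mean r ramp_kernel - mean_at r Phi| <= e / 2.
  by apply: (mean_at_dist T_lf r0 N0); near: r; exact: U.
move: h1 h2; rewrite !ler_norml => /andP[? ?] /andP[? ?].
by apply/andP; split; lra.
Unshelve. all: by end_near. Qed.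

Lemma ramp_avg_ge : psi_ratio n l <= ball_avg Phi.
Proof.
rewrite psi_ratioE; apply: ball_avg_le.
- apply: unit_valued_integrable.
    by apply: measurable_ball_avg; [exact: measurable_close_kernel|exact: close_kernel01].
  by apply: unit_valued_ball_avg; [exact: measurable_close_kernel|exact: close_kernel01].
- by have [] := ramp_avg_admissible.
move=> a _; apply: ball_avg_le.
- apply: unit_valued_integrable; last exact: close_kernel01.
  exact: (measurableT_comp (measurable_close_kernel l) (measurable_pair1 a)).
- exact: ramp_kernel_integrable.
move=> b _; rewrite /close_kernel; case: (leP (norm2 (a - b))) => [h|_]; last by case/andP: (ramp_kernel01 a b).
by rewrite /ramp_kernel ramp_ge.
Qed.

Lemma ramp_avg_le : ball_avg Phi <= psi_ratio n (l + d).
Proof.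
rewrite psi_ratioE; apply: ball_avg_le.
- by have [] := ramp_avg_admissible.
- apply: unit_valued_integrable.
    by apply: measurable_ball_avg; [exact: measurable_close_kernel|exact: close_kernel01].
  by apply: unit_valued_ball_avg; [exact: measurable_close_kernel|exact: close_kernel01].
move=> a _; apply: ball_avg_le.
- exact: ramp_kernel_integrable.
- apply: unit_valued_integrable; last exact: close_kernel01.
  exact: (measurableT_comp (measurable_close_kernel _) (measurable_pair1 a)).
move=> b _; rewrite /close_kernel; case: (leP (norm2 (a - b))) => [_|h]; first by case/andP: (ramp_kernel01 a b).
by rewrite /ramp_kernel ramp_le// ltW.
Qed.

End ramp_kernel.

(** The proportion of close pairs is an iterated mean of an indicator, so limits can be
    taken in one point at a time. *)
Lemma close_pairs_ratioE l r : 0 < r ->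
  (ncard (close_pairs T l r))%:R / (ncard (pairs T r))%:R =
  pair_mean r (close_kernel l).
Proof.
move=> r0.
have fW := window_finite T_lf r.
have fWW : finite_set (window T r `*` window T r) by exact: finite_setX.
have pE : pairs T r = window T r `*` window T r.
  apply/seteqP; split=> -[a b] /=; rewrite /window /cball/=.
    by move=> [/= Ta Tb ar br]; rewrite !subr0.
  by rewrite !subr0 => -[[? ?] [? ?]].
have cE : close_pairs T l r =
    (window T r `*` window T r) `&` [set p | norm2 (p.1 - p.2) <= l * r].
  by rewrite -pE; apply/seteqP; split=> p; [case=> *; split|case=> -[]].
have -> : (ncard (pairs T r))%:R = window_card r * window_card r.
  rewrite ncardE pE// -(@pair_fsbig _ _ _ _ _ _ _ (fun _ _ => 1 : R))//.
  under eq_fsbigr do rewrite -(ncardE R fW).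
  by rewrite fsbig_finite// big_const_seq count_predT iter_addr_0 -[LHS]mulr_natr.
have -> : (ncard (close_pairs T l r))%:R =
    \sum_(a <- fset_set (window T r)) \sum_(b <- fset_set (window T r))
      close_kernel l (r^-1 *: a) (r^-1 *: b).
  rewrite (ncardE R); last by rewrite cE; exact: finite_setIl.
  rewrite cE fsbig_mkcondr.
  rewrite -(@pair_fsbig _ _ _ _ _ _ _ (fun a b => if (a, b) \in
     [set p : V * V | norm2 (p.1 - p.2) <= l * r] then 1 else 0 : R))//.
  rewrite fsbig_finite//; apply: eq_bigr => a _; rewrite fsbig_finite//.
  apply: eq_bigr => b _; rewrite /close_kernel -scalerBr norm2Z.
  rewrite gtr0_norm ?invr_gt0// [r^-1 * _]mulrC ler_pdivrMr//.
  by case: ifPn; rewrite ?inE ?notin_setE/=; [move=> ->|move/negP/negbTE ->].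
rewrite /pair_mean /mean_at invfM mulrA mulrAC; congr (_ / _).
by rewrite mulr_suml.
Qed.

End pair_averages.

(** * The limit of the proportion of close pairs *)

Section psi_modulus.
Context {R : realType}.
Variable k : nat.
Local Notation C := (k.+1%:R * 2 ^+ k.+1 : R).

Lemma psi_ratio_modulus_right (l d : R) : 0 <= l <= 2 -> 0 <= d ->
  psi_ratio k.+1 (l + d) <= psi_ratio k.+1 l + C * d.
Proof.
move=> /andP[l0 l2] d0; have C0 : 0 <= C by rewrite mulr_ge0// exprn_ge0.
have [ld2|ld2] := leP (l + d) 2.
  have ll : 0 <= l <= l + d by rewrite l0 lerDl.
  by have := psi_ratio_lip k ll ld2; rewrite [l + d - l]addrAC subrr add0r lerBlDl.
have l02 : 0 <= l <= 2 by rewrite l0 l2.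
have := psi_ratio_lip k l02 (lexx _).
rewrite (psi_ratio_ge2 _ (lexx 2)) (psi_ratio_ge2 _ (ltW ld2)).
rewrite lerBlDl => /le_trans; apply; rewrite lerD2l ler_wpM2l//; lra.
Qed.

Lemma psi_ratio_modulus_left (l d : R) : 0 <= l <= 2 -> 0 <= d ->
  psi_ratio k.+1 l <= psi_ratio k.+1 (l - d) + C * d.
Proof.
move=> /andP[l0 l2] d0; have C0 : 0 <= C by rewrite mulr_ge0// exprn_ge0.
have [ld0|ld0] := leP 0 (l - d).
  have ll : 0 <= l - d <= l by rewrite ld0 gerBl.
  by have := psi_ratio_lip k ll l2; rewrite opprB addrCA subrr addr0 lerBlDl.
have l00 : (0 : R) <= 0 <= l by rewrite lexx l0.
have := psi_ratio_lip k l00 l2; rewrite psi_ratio0 !subr0 => /le_trans; apply.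
by rewrite psi_ratio_lt0// add0r ler_wpM2l//; lra.
Qed.

End psi_modulus.

(** x is squeezed between w and u, where u is e / 2-close to a <= p + e / 2 and w is
    e / 2-close to b >= p - e / 2. *)
Lemma dist_squeeze (R : realFieldType) (e p x u w a b pl pr : R) :
  x <= u -> w <= x -> a <= pr -> pl <= b ->
  pr <= p + e / 2 -> p <= pl + e / 2 ->
  `|a - u| <= e / 2 -> `|b - w| <= e / 2 -> `|p - x| <= e.
Proof.
move=> h1 h2 h3 h4 h5 h6; rewrite !ler_norml => /andP[? ?] /andP[? ?].
by apply/andP; split; lra.
Qed.

(** The indicator of distance at most l lies between the ramps that fall to 0 on
    [l - d, l] and on [l, l + d]. The limits for the ramps lie between psi_ratio at
    l - d and at l + d, which are close to its value at l. *)
Lemma close_pair_mean_cvg (R : realType) k (T : set 'rV[R]_k.+1) (l : R) :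
  locally_finite T -> eventually_nonempty T ->
  angular_condition T -> radial_condition T -> 0 <= l <= 2 ->
  pair_mean T r (close_kernel l) @[r --> +oo] --> psi_ratio k.+1 l.
Proof.
move=> T_lf T_ne T_ang T_rad l02; apply/cvgrPdist_le => e e0.
pose C : R := k.+1%:R * 2 ^+ k.+1.
have C0 : 0 < C by rewrite mulr_gt0// exprn_gt0.
(* C is a Lipschitz constant of psi_ratio, so a shift by d changes it by at most e / 2. *)
pose d := e / 2 / C.
have d0 : 0 < d by rewrite !divr_gt0.
have Cd : C * d = e / 2 by rewrite /d mulrC divfK// gt_eqF.
have e20 : 0 < e / 2 by rewrite divr_gt0.
have cvg_ramp a := @ramp_pair_mean R k.+1 T (ltn0Sn k) T_lf T_ne T_ang T_rad a d d0.
have /cvgrPdist_le /(_ _ e20) up := cvg_ramp l.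
have /cvgrPdist_le /(_ _ e20) lo := cvg_ramp (l - d).
near=> r.
have r0 : 0 < r by near: r; exact: nbhs_pinfty_gt.
have h1 : pair_mean T r (close_kernel l) <= pair_mean T r (ramp_kernel l d).
  apply: (pair_mean_le T_lf r0) => a b; rewrite /close_kernel /ramp_kernel.
  case: (leP (norm2 (a - b))) => [h|_]; first by rewrite ramp_ge.
  by case/andP: (ramp01 l d (norm2 (a - b))).
have h2 : pair_mean T r (ramp_kernel (l - d) d) <= pair_mean T r (close_kernel l).
  apply: (pair_mean_le T_lf r0) => a b; rewrite /close_kernel /ramp_kernel.
  case: (leP (norm2 (a - b))) => [_|h].
    by case/andP: (ramp01 (l - d) d (norm2 (a - b))).
  by rewrite ramp_le// subrK ltW.
have h3 := @ramp_avg_le R k.+1 T (ltn0Sn k) T_lf T_ne T_ang T_rad l d d0.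
have h4 := @ramp_avg_ge R k.+1 T (ltn0Sn k) T_lf T_ne T_ang T_rad (l - d) d d0.
have h5 := psi_ratio_modulus_right k l02 (ltW d0).
have h6 := psi_ratio_modulus_left k l02 (ltW d0).
rewrite -/C Cd in h5 h6.
have h7 : `|ball_avg (fun a : 'rV[R]_k.+1 => ball_avg (ramp_kernel l d a)) -
    pair_mean T r (ramp_kernel l d)| <= e / 2 by near: r; exact: up.
have h8 : `|ball_avg (fun a : 'rV[R]_k.+1 => ball_avg (ramp_kernel (l - d) d a)) -
    pair_mean T r (ramp_kernel (l - d) d)| <= e / 2 by near: r; exact: lo.
exact: dist_squeeze h1 h2 h3 h4 h5 h6 h7 h8.
Unshelve. all: by end_near. Qed.

Theorem mainTheorem1 (R : realType) (n : nat) (hn : (1 <= n)%N)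
    (T : set 'rV[R]_n) (T_countable : countable T)
    (T_locally_finite : locally_finite T)
    (T_eventually_nonempty : eventually_nonempty T)
    (T_angular : angular_condition T) (T_radial : radial_condition T) :
  (forall lambda : R, 0 <= lambda <= 2 ->
     [/\ (ncard (close_pairs T lambda r))%:R / (ncard (pairs T r))%:R
           @[r --> +oo] --> F_ n lambda &
         (lebesgue_rV (n + n) (Psi n lambda) / lebesgue_rV n (cball 0 1) ^+ 2)%E
           = (F_ n lambda)%:E]) /\
  cdf_with_density (F_ n : R -> R) (P_ n).
Proof.
case: n hn T T_countable T_locally_finite T_eventually_nonempty T_angular T_radial.
  by [].
move=> k _ T _ T_lf T_ne T_ang T_rad; split; last exact: cdf_F.
move=> l l02; split; last by rewrite lebesgue_PsiE psi_ratio_F.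
rewrite -psi_ratio_F//.
have lim := close_pair_mean_cvg T_lf T_ne T_ang T_rad l02.
apply: (cvg_trans _ lim); apply: near_eq_cvg; near=> r.
by rewrite (close_pairs_ratioE T_lf).
Unshelve. all: by end_near. Qed.
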